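(* Let $d\ge3$ and $\delta>0$. There is a constant $c=c(d,\delta)>0$ such that the following hold. (a) Let $(G_n)_{n\ge1}$ be any essentially large girth sequence of finite $d$-regular graphs, and let $\omega_n\subseteq V(G_n)$ be an FIID subgraph of this sequence of positive density. If its average degree is at least $2+\delta$, then its density is at least $c$. (b) Let $G_{n,d}$ be the uniform random $d$-regular graph on $n$ vertices. With probability tending to $1$ as $n\to\infty$, every nonempty subgraph of $G_{n,d}$ of average degree at least $2+\delta$ has density at least $c$, i.e., has at least $cn$ vertices.
   Context: A sequence of finite $d$-regular graphs $G_n$ with $|V(G_n)|\to\infty$ has essentially large girth if for every $k$ the number of cycles of length at most $k$ in $G_n$ is $o(|V(G_n)|)$; equivalently, it converges to the $d$-regular tree in the Benjamini–Schramm sense. An FIID subgraph of the sequence is given by a radius $r$ and a measurable $\{0,1\}$-valued function $f$ (both independent of $n$) on isomorphism classes of rooted graphs of radius at most $r$ with vertex labels in $[0,1]$: put i.i.d. $\mathrm{Unif}[0,1]$ labels on $V(G_n)$, and let $\omega_n$ be the set of vertices $v$ for which $f$ of the labelled $r$-ball around $v$ equals $1$. With $o_n$ a uniformly random vertex of $G_n$, independent of the labels, the density of the FIID subgraph is $\lim_{n\to\infty}\mathbb P(o_n\in\omega_n)$ and its average degree is $\lim_{n\to\infty}\mathbb E[\deg_{\omega_n}(o_n)\mid o_n\in\omega_n]$, where $\deg_{\omega_n}(v)$ is the number of neighbours of $v$ in $\omega_n$; these limits exist (the second one whenever the density is positive). In (b), $n$ ranges over integers with $nd$ even, and the average degree of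 a finite graph is twice its number of edges divided by its number of vertices. *)

(* Defs.v *)
From HB Require Import structures.
From mathcomp Require Import all_boot all_order all_algebra.
From mathcomp Require Import all_classical all_reals all_analysis.

Set Implicit Arguments.
Unset Strict Implicit.
Unset Printing Implicit Defensive.

Import Order.TTheory GRing.Theory Num.Theory.
Import numFieldNormedType.Exports.

Local Open Scope classical_set_scope.
Local Open Scope ring_scope.

(* A graph on the finite type V is given by its set of edges E, each edge being
   a two-element set of vertices. *)
Section Graphs.
Variable V : finType.
Implicit Types (E F : {set {set V}}) (W : {set V}) (v x y : V).

Definition simple_graph E : bool := [forall e in E, #|e| == 2%N].

(* Irreflexive when E is simple, since [set x; x] has one element. *)
Definition adj E : rel V := fun x y => [set x; y]%SET \in E.

Definition nbrs E v : {set V} := [set y | adj E v y].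

Definition regular (d : nat) E : bool := [forall v, #|nbrs E v| == d].

Definition subgraph W F E : bool :=
  (F \subset E) && [forall e in F, e \subset W].

Definition avg_degree (R : realType) W F : R := (2 * #|F|)%:R / #|W|%:R.

(* A cycle is identified with its set of edges, so that it is counted once and
   not once for each base point and direction. *)
Definition cycle_edges (c : seq V) : {set {set V}} :=
  [set [set x; next c x]%SET | x in c].

Definition cycles_of_length (l : nat) E : {set {set {set V}}} :=
  [set cycle_edges c | c : l.-tuple V & ucycleb (adj E) c].

Definition num_cycles (k : nat) E : nat :=
  \sum_(3 <= l < k.+1) #|cycles_of_length l E|.

Fixpoint gball E (r : nat) v : {set V} :=
  if r is r'.+1 then
    gball E r' v :|: [set y | [exists x in gball E r' v, adj E x y]]
  else [set v]%SET.

Lemma mem_gball E r v : v \in gball E r v.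
Proof. by elim: r => [|r IH] /=; rewrite inE ?eqxx ?IH. Qed.

Definition gball_type E r v : finType := {x : V | x \in gball E r v}.

(* The r-ball is the induced subgraph on the vertices at distance at most r. *)
Definition gball_edges E r v : {set {set gball_type E r v}} :=
  [set e : {set gball_type E r v} | val @: e \in E].

Definition gball_root E r v : gball_type E r v := exist _ v (mem_gball E r v).

End Graphs.

Definition essentially_large_girth (R : realType) (V : nat -> finType)
    (E : forall n, {set {set V n}}) : Prop :=
  (fun n => #|V n|%:R : R) @ \oo --> +oo /\
  forall k, (fun n => (num_cycles k (E n))%:R : R) =o_\oo
            (fun n => #|V n|%:R : R).

(* A measurable {0,1}-valued function on isomorphism classes of finite rooted
   graphs with labelled vertices.  The rule is defined for all finite rooted
   graphs and for all real labels, but only its values at balls of a fixed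
   radius with labels in [0,1] play a role.  For a fixed rooted graph the
   labellings are identified with #|B|-tuples, to use the product sigma-algebra
   on tuples. *)
Record fiid_rule (R : realType) := FiidRule {
  rule :> forall B : finType, {set {set B}} -> B -> (B -> R) -> bool;
  rule_iso : forall (B B' : finType) (h : B -> B') (E : {set {set B}}) (o : B)
      (x : B' -> R), bijective h ->
    rule [set h @: e | e : {set B} in E]%SET (h o) x = rule E o (x \o h);
  rule_measurable : forall (B : finType) (E : {set {set B}}) (o : B),
    measurable_fun [set: #|B|.-tuple R]
      (fun t => rule E o (fun b => tnth t (enum_rank b)))
}.

Definition fiid_set (R : realType) (V : finType) (E : {set {set V}}) (r : nat)
    (f : fiid_rule R) (x : V -> R) : {set V} :=
  [set v | f _ (gball_edges E r v) (gball_root E r v) (x \o val)].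

Definition independent_families d (T : measurableType d) (R : realType)
    (P : probability T R) (I : finType) (A : I -> set (set T)) : Prop :=
  forall (J : {set I}) (B : I -> set T), (forall i, i \in J -> A i (B i)) ->
    P (\bigcap_(i in [set` J]) B i) = (\prod_(i in J) P (B i))%E.

(* A probability space carrying i.i.d. Unif[0,1] labels on V and a uniformly
   random vertex of V that is independent of the labels; the index None stands
   for the random vertex. *)
Record labelled_space (R : realType) (V : finType) := LabelledSpace {
  disp : measure_display;
  Omega : measurableType disp;
  Pr : probability Omega R;
  label : V -> {RV Pr >-> R};
  vertex : Omega -> V;
  label_uniform : forall v (A : set R), measurable A ->
    distribution Pr (label v) A = uniform_prob (@ltr01 R) A;
  vertex_measurable : forall v, measurable (vertex @^-1` [set v]);
  vertex_uniform : forall v, Pr (vertex @^-1` [set v]) = (#|V|%:R^-1)%:E;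
  label_vertex_independent : independent_families Pr (fun i : option V =>
    if i is Some v then [set label v @^-1` A | A in measurable]
    else [set vertex @^-1` D | D in setT])
}.

Definition cond_expectation d (T : measurableType d) (R : realType)
    (P : probability T R) (X : T -> R) (A : set T) : R :=
  fine (\int[P]_(w in A) (X w)%:E) / fine (P A).

Section FiidSubgraph.
Variables (R : realType) (r : nat) (f : fiid_rule R).

Section OneGraph.
Variables (V : finType) (E : {set {set V}}) (L : labelled_space R V).

Definition omega (w : Omega L) : {set V} :=
  fiid_set E r f (fun v => label L v w).

Definition vertex_in_omega : set (Omega L) :=
  [set w | vertex w \in omega w].

Definition deg_omega (w : Omega L) (v : V) : nat :=
  #|omega w :&: nbrs E v|.

Definition density_at : R := fine (Pr L vertex_in_omega).

Definition avg_degree_at : R :=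
  cond_expectation (Pr L) (fun w => (deg_omega w (vertex w))%:R)
    vertex_in_omega.

End OneGraph.

Variables (V : nat -> finType) (E : forall n, {set {set V n}}).
Variable L : forall n, labelled_space R (V n).

(* lim is 0 at a divergent real sequence, so that a positive density or average
   degree is always that of a convergent sequence. *)
Definition fiid_density : R := lim ((fun n => density_at (E n) (L n)) @ \oo).

Definition fiid_avg_degree : R :=
  lim ((fun n => avg_degree_at (E n) (L n)) @ \oo).

End FiidSubgraph.

Definition regular_graphs (n d : nat) : {set {set {set 'I_n}}} :=
  [set E | simple_graph E && regular d E].

(* Probability of the event A under the uniform distribution on S. *)
Definition unif_pr (R : realType) (T : finType) (S : {set T}) (A : T -> Prop)
    : R :=
  #|[set x in S | `[< A x >]]|%:R / #|S|%:R.

(* Main.v *)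
Require Import Defs.
From HB Require Import structures.
From mathcomp Require Import all_boot all_order all_fingroup all_algebra.
From mathcomp Require Import all_classical all_reals all_analysis.
From mathcomp Require Import measurable_realfun zify ring lra.
Import Order.TTheory GRing.Theory Num.Theory.
Import numFieldNormedType.Exports.

Set Implicit Arguments.
Unset Strict Implicit.
Unset Printing Implicit Defensive.

(** Part (b) is a first moment bound. If F has at most a small multiple of n
    edges, replacing two edges xy, uv by xu, yv (xy in F) and double counting
    shows that a uniform d-regular graph contains F with probability at most
    (2d/n)^|F|. Summing over vertex sets of size s and sets of (1 + 1/k) s edges
    inside them, the expected number of dense subgraphs with s vertices is at
    most (C s/n)^(s/k), whose sum over 1 <= s <= c n tends to 0.

    Part (a) follows from (b). The same counting shows that a random d-regular
    graph E' on the vertex set of G_n has few short cycles, so some E' has few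
    short cycles and no small dense subgraphs. The labels of G_n are also labels
    for E'. Around all but o(n) vertices both graphs have isomorphic tree-like
    balls, and i.i.d. labels are exchangeable, so the expected size and degree sum
    of the FIID set are the same in G_n and E' up to o(n). In E' the memberships
    of far apart vertices are independent, hence the size of the FIID set
    concentrates; if the density were below c, the set would typically be small,
    hence sparse in E', against the assumption on the average degree. *)

(** * Switchings in regular graphs *)

(** The surplus of [s/k] edges is what makes the first moment small: there are about [(n/s)^s]
    vertex sets of size [s], each of the [(1 + 1/k) s] edges contributes a factor of order [s/n],
    and [s/k] such factors are left over. The integer [k] stands in for [delta] so that edge counts
    stay integral. It is taken above [4 / delta] although [2 / delta] suffices for (b); the slack
    absorbs the error terms of (a). The obstacle in (a) is that a large girth sequence need not
    itself have the property in (b): a disjoint union of [m] large girth graphs of equal order has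
    components of density [1/m] and average degree [d]. A local rule cannot tell such a graph from a
    random one, so the sparsity of a random graph can be used instead. With the random graph on the
    same vertex set, one labelled space serves both graphs, and a local isomorphism, extended to a
    permutation of the vertices, reduces the comparison to exchangeability. *)

Section Degrees.
Import boot.fintype boot.finset.
Local Open Scope set_scope.
Local Open Scope nat_scope.
Variable V : finType.
Implicit Types (E F : {set {set V}}) (v x y : V).

Lemma adjC E x y : adj E x y = adj E y x.
Proof. by rewrite /adj setUC. Qed.

Lemma in_nbrs E x y : (y \in nbrs E x) = ([set x; y] \in E).
Proof. by rewrite inE. Qed.

Lemma adj_neq E x y : simple_graph E -> [set x; y] \in E -> x != y.
Proof.
move=> /forall_inP sE /sE; apply: contraTneq => ->.
by rewrite setUid cards1.
Qed.

Lemma simple_edgeP E e v : simple_graph E -> e \in E -> v \in e ->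
  exists2 y, v != y & e = [set v; y].
Proof.
move=> /forall_inP sE /sE /cards2P[x [y [xy ->]]]; rewrite !inE.
case/orP => /eqP ->; first by exists y.
by exists x; [rewrite eq_sym|rewrite setUC].
Qed.

Lemma eq_set2l v x y : v != x -> [set v; x] = [set v; y] -> x = y.
Proof.
move=> vx /setP/(_ x); rewrite !inE eqxx orbT [x == v]eq_sym (negbTE vx) /=.
by move/esym/eqP.
Qed.

Lemma card_nbrsE E v : simple_graph E -> #|nbrs E v| = \sum_(e in E) (v \in e).
Proof.
move=> sE; rewrite -big_mkcondr /= sum1dep_card.
have -> : [set e in E | v \in e] = [set [set v; y] | y in nbrs E v].
  apply/setP => e; rewrite inE; apply/andP/imsetP => [[eE ve]|[y + ->]].
    have [y _ eq_e] := simple_edgeP sE eE ve; exists y => //.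
    by rewrite in_nbrs -eq_e.
  by rewrite in_nbrs => ->; rewrite !inE eqxx.
rewrite card_in_imset // => y z; rewrite !in_nbrs => vy _.
exact: eq_set2l (adj_neq sE vy).
Qed.

Lemma card_adj_pairs d E : regular d E ->
  #|[set p : V * V | [set p.1; p.2] \in E]| = (#|V| * d)%N.
Proof.
move=> /forallP rE; rewrite -sum1_card.
rewrite (eq_bigl (fun p : V * V => p.2 \in nbrs E p.1)); last first.
  by move=> p; rewrite inE in_nbrs.
rewrite -(pair_big_dep xpredT (fun x y => y \in nbrs E x) (fun _ _ => 1%N)) /=.
under eq_bigr do rewrite sum1_card (eqP (rE _)).
by rewrite sum_nat_const.
Qed.

Lemma card_nbr_pairs d E (X : {set V}) : regular d E ->
  #|[set p : V * V | (p.1 \in X) && (p.2 \in nbrs E p.1)]| = (#|X| * d)%N.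
Proof.
move=> /forallP rE; rewrite -sum1_card.
rewrite (eq_bigl (fun p : V * V => (p.1 \in X) && (p.2 \in nbrs E p.1))); last first.
  by move=> p; rewrite inE.
rewrite -(pair_big_dep (mem X) (fun x y => y \in nbrs E x) (fun _ _ => 1%N)) /=.
under eq_bigr do rewrite sum1_card (eqP (rE _)).
by rewrite sum_nat_const.
Qed.

Lemma card_ordered_pairs (F : {set {set V}}) : simple_graph F ->
  (#|[set p : V * V | [set p.1; p.2] \in F]| <= 2 * #|F|)%N.
Proof.
move=> sF; rewrite -sum1_card (partition_big (fun p : V * V => [set p.1; p.2])
  (mem F)) /=; last by move=> p; rewrite inE.
rewrite mulnC -sum_nat_const; apply: leq_sum => e eF.
have /forall_inP/(_ _ eF) := sF; move=> /cards2P[x [y [xy ->]]].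
rewrite sum1dep_card; apply: (@leq_trans #|[set (x, y); (y, x)]|); last first.
  by rewrite cards2; case: (_ != _).
apply: subset_leq_card; apply/subsetP => -[a b]; rewrite !inE /= => /andP[abF /eqP abxy].
have ab := adj_neq sF abF.
have : a \in [set x; y] by rewrite -abxy !inE eqxx.
have : b \in [set x; y] by rewrite -abxy !inE eqxx orbT.
rewrite !inE !xpair_eqE => /orP[]/eqP ? /orP[]/eqP ?; subst; rewrite ?eqxx ?orbT //.
by rewrite eqxx in ab.
by rewrite eqxx in ab.
Qed.

End Degrees.

(** * Counting the graphs that contain given edges *)

Section Switching.
Import boot.fintype boot.finset.
Local Open Scope set_scope.
Local Open Scope nat_scope.

Lemma card_pair_dep (A B : finType) (P : pred A) (Q : A -> pred B) :
  #|[set p : A * B | P p.1 && Q p.1 p.2]| = \sum_(a | P a) #|[set b | Q a b]|.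
Proof.
rewrite -sum1dep_card -(pair_big_dep P Q (fun _ _ => 1)) /=.
by apply: eq_bigr => a _; rewrite sum1dep_card.
Qed.

Variables (V : finType) (d : nat).
Implicit Types (E F : {set {set V}}) (x y u v : V).

Definition regular_supergraphs F : {set {set {set V}}} :=
  [set E | [&& simple_graph E, regular d E & F \subset E]].

Definition switch E x y u v : {set {set V}} :=
  [set x; u] |: ([set y; v] |: (E :\ [set x; y] :\ [set u; v])).

(** The new pairs [xu] and [yv] must be neither loops nor edges of [E]. When [xy] is an edge of a
    simple graph, this already makes [x], [y], [u], [v] pairwise distinct. *)
Definition switchable E x y u v :=
  [&& [set u; v] \in E, u != x, u \notin nbrs E x, v != y & v \notin nbrs E y].

Section OneSwitch.
Variables (E : {set {set V}}) (x y u v : V).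
Hypotheses (sE : simple_graph E) (xyE : [set x; y] \in E)
  (sw : switchable E x y u v).

Let uvE : [set u; v] \in E. Proof. by case/and5P: sw. Qed.
Let ux : u != x. Proof. by case/and5P: sw. Qed.
Let vy : v != y. Proof. by case/and5P: sw. Qed.
Let xuE : [set x; u] \notin E. Proof. by rewrite -in_nbrs; case/and5P: sw. Qed.
Let yvE : [set y; v] \notin E. Proof. by rewrite -in_nbrs; case/and5P: sw. Qed.
Let xy : x != y. Proof. exact: adj_neq sE xyE. Qed.
Let uv : u != v. Proof. exact: adj_neq sE uvE. Qed.
Let uy : u != y. Proof. by apply: contraNneq yvE => <-. Qed.
Let vx : v != x.
Proof. by apply: contraNneq xuE => <-; rewrite setUC. Qed.

Let xu_yv : [set x; u] != [set y; v].
Proof.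
apply/eqP => /setP/(_ x); rewrite !inE eqxx /=.
by rewrite (negbTE xy) [x == v]eq_sym (negbTE vx).
Qed.

Let uv_xy : [set u; v] != [set x; y].
Proof.
by apply/eqP => /setP/(_ u); rewrite !inE eqxx /= (negbTE ux) (negbTE uy).
Qed.

Lemma switch_simple : simple_graph (switch E x y u v).
Proof.
apply/forall_inP => e; rewrite !inE => /or3P[/eqP->|/eqP->|/and3P[_ _ eE]].
- by rewrite cards2 [x == u]eq_sym ux.
- by rewrite cards2 [y == v]eq_sym vy.
by have /forall_inP/(_ _ eE) := sE.
Qed.

Lemma switch_regular : regular d E -> regular d (switch E x y u v).
Proof.
move=> /forallP rE; apply/forallP => w; rewrite -(eqP (rE w)).
rewrite (card_nbrsE _ switch_simple) (card_nbrsE _ sE) /switch.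
rewrite big_setU1 /=; last first.
  by rewrite !inE (negbTE xu_yv) (negbTE xuE) /= !andbF.
rewrite big_setU1 /=; last by rewrite !inE (negbTE yvE) /= !andbF.
rewrite [in X in _ == X](big_setD1 _ xyE) /=.
rewrite [in X in _ == X](big_setD1 [set u; v]) /=; last by rewrite !inE uvE uv_xy.
rewrite !addnA; apply/eqP; congr (_ + _); rewrite !inE.
have Hn : forall a b : V, a != b -> ((w == a) || (w == b)) = (w == a) + (w == b) :> nat.
  by move=> a b ab; case: (eqVneq w a) => // ->; rewrite (negbTE ab).
rewrite (Hn x u) 1?eq_sym // (Hn y v) 1?eq_sym // (Hn x y) // (Hn u v) //.
move: (nat_of_bool (w == x)) (nat_of_bool (w == y)) (nat_of_bool (w == u)).
by move: (nat_of_bool (w == v)) => *; ring.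
Qed.

(** Makes switching injective in [E] for fixed [x], [y], [u], [v], as the double count needs. *)
Lemma switch_inv :
  E = [set x; y] |: ([set u; v] |:
        (switch E x y u v :\ [set x; u] :\ [set y; v])).
Proof.
apply/setP => e; rewrite !inE.
case: (eqVneq e [set x; y]) => [->|exy] /=; first by rewrite xyE.
case: (eqVneq e [set u; v]) => [->|euv] /=; first by rewrite uvE.
case: (eqVneq e [set x; u]) => [->|exu] /=; first by rewrite andbF (negbTE xuE).
by case: (eqVneq e [set y; v]) => [->|eyv] /=; rewrite ?(negbTE yvE).
Qed.

Lemma mem_switch_nbrs :
  u \in nbrs (switch E x y u v) x /\ v \in nbrs (switch E x y u v) y.
Proof. by rewrite !in_nbrs /switch !inE !eqxx /= orbT. Qed.

Lemma switch_supset F : F \subset E -> [set u; v] \notin F ->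
  F :\ [set x; y] \subset switch E x y u v.
Proof.
move=> /subsetP FE uvF; apply/subsetP => e; rewrite !inE => /andP[-> eF].
by rewrite (FE _ eF) andbT (_ : e != _) ?orbT //; apply: contraNneq uvF => <-.
Qed.

End OneSwitch.

(** Of the [#|V| * d] ordered edges, at most [2 * #|F|] lie in [F], and at most [d.+1 * d] have [u]
    in the closed neighbourhood of [x], likewise for [v] and [y]. *)
Lemma card_switchable E F x y : simple_graph E -> regular d E -> F \subset E ->
  #|V| * d <= #|[set p : V * V | switchable E x y p.1 p.2 &&
                  ([set p.1; p.2] \notin F)]| + 2 * #|F| + 2 * (d.+1 * d).
Proof.
move=> sE rE FE.
have sF : simple_graph F.
  by apply/forall_inP => e /(subsetP FE); move/forall_inP: sE; apply.
rewrite -(card_adj_pairs rE).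
pose B x := [set p : V * V | (p.1 \in x |: nbrs E x) && (p.2 \in nbrs E p.1)].
pose B' := [set p : V * V | [set p.1; p.2] \in F].
pose S := [set p : V * V | switchable E x y p.1 p.2 && ([set p.1; p.2] \notin F)].
have cB z : #|B z| <= d.+1 * d.
  rewrite (card_nbr_pairs _ rE) leq_mul2r; apply/orP; right.
  by rewrite cardsU1 (eqP (forallP rE z)); case: (_ \notin _).
pose tr (p : V * V) := (p.2, p.1).
have sub : [set p : V * V | [set p.1; p.2] \in E] \subset
    S :|: B' :|: B x :|: tr @^-1: B y.
  apply/subsetP => -[a b]; rewrite !inE /= /switchable !inE /adj => abE.
  rewrite (setUC [set b]) abE /=.
  case: (_ \in F) => /=; rewrite ?orbT //= !andbT ?orbF.
  case: (a == x) => //=; rewrite ?orbT //.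
  case: ([set x; a] \in E) => //=; rewrite ?orbT //.
  case: (b == y) => //=; rewrite ?orbT //.
  by case: ([set y; b] \in E).
apply: leq_trans (subset_leq_card sub) _.
have trI : injective tr by move=> [a b] [a' b'] [-> ->].
have cT : #|tr @^-1: B y| <= d.+1 * d.
  rewrite -(card_imset _ trI); apply: leq_trans (cB y).
  by apply: subset_leq_card; apply/subsetP => _ /imsetP[p + ->]; rewrite inE.
have := card_ordered_pairs sF; rewrite -/B' => cB'.
have := cB x => cBx.
have [c1 _] := leq_card_setU (S :|: B' :|: B x) (tr @^-1: B y).
have [c2 _] := leq_card_setU (S :|: B') (B x).
have [c3 _] := leq_card_setU S B'.
rewrite -/S; move: c1 c2 c3 cB' cBx cT; move: (d.+1 * d)%N => k.
lia.
Qed.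

(* With e = xy, a graph containing F admits at least m switchings, and a graph
   is the result of at most d * d of them: u is a neighbour of x and v of y. *)
Lemma supergraphs_switch F e m : e \in F ->
  m + 2 * #|F| + 2 * (d.+1 * d) <= #|V| * d ->
  #|regular_supergraphs F| * m <= #|regular_supergraphs (F :\ e)| * (d * d).
Proof.
move=> eF Hm.
case: (set_0Vmem (regular_supergraphs F)) => [->|[E0 E0F]]; first by rewrite cards0.
have [x [y exy]] : exists x y, e = [set x; y].
  move: E0F; rewrite inE => /and3P[/forall_inP sE0 _ /subsetP/(_ _ eF)].
  by move=> /sE0/cards2P[x [y [_ ->]]]; exists x, y.
pose Q E (p : V * V) := switchable E x y p.1 p.2 && ([set p.1; p.2] \notin F).
pose A := [set q : {set {set V}} * (V * V) |
  (q.1 \in regular_supergraphs F) && Q q.1 q.2].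
pose Q' E (p : V * V) := (p.1 \in nbrs E x) && (p.2 \in nbrs E y).
pose B := [set q : {set {set V}} * (V * V) |
  (q.1 \in regular_supergraphs (F :\ e)) && Q' q.1 q.2].
pose h (q : {set {set V}} * (V * V)) := (switch q.1 x y q.2.1 q.2.2, q.2).
have hI : {in A &, injective h}.
  move=> [E [u v]] [E' [u' v']]; rewrite !inE /=.
  move=> /andP[/and3P[sE rE /subsetP FE] /andP[sw _]].
  move=> /andP[/and3P[sE' rE' /subsetP FE'] /andP[sw' _]] [eqE eu ev].
  rewrite -{u'}eu -{v'}ev in eqE sw' *.
  have xyE : [set x; y] \in E by rewrite -exy FE.
  have xyE' : [set x; y] \in E' by rewrite -exy FE'.
  by rewrite (switch_inv xyE sw) eqE -(switch_inv xyE' sw').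
have hB : h @: A \subset B.
  apply/subsetP => _ /imsetP[[E [u v]] + ->]; rewrite !inE /=.
  move=> /andP[/and3P[sE rE FE] /andP[sw uvF]].
  have xyE : [set x; y] \in E by rewrite -exy (subsetP FE).
  rewrite (switch_simple sE sw) (switch_regular sE xyE sw rE) /=.
  by rewrite exy switch_supset //= /Q' /=; case: (mem_switch_nbrs E x y u v) => -> ->.
apply: (@leq_trans #|A|).
  rewrite /A card_pair_dep -sum_nat_const; apply: leq_sum => E /=.
  rewrite inE => /and3P[sE rE FE].
  have := card_switchable x y sE rE FE; rewrite -addnA => c.
  move: Hm; rewrite -addnA; move: (2 * #|F| + 2 * (d.+1 * d)) c => K c Hm.
  by rewrite -(leq_add2r K); exact: leq_trans Hm c.
rewrite -(card_in_imset hI); apply: leq_trans (subset_leq_card hB) _.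
rewrite /B card_pair_dep -sum_nat_const; apply: leq_sum => E EF.
have : E \in regular_supergraphs (F :\ e) by []; rewrite inE => /and3P[sE /forallP rE _].
rewrite -[X in (_ <= X * _)](eqP (rE x)) -[X in (_ <= _ * X)](eqP (rE y)).
rewrite -cardsX; apply: subset_leq_card; apply/subsetP => -[a b].
by rewrite !inE.
Qed.

(** The edges of [F] are removed one at a time. The size condition leaves at least half of the
    [#|V| * d] ordered edges available for switching, so each removal costs a factor
    [d * d / (#|V| * d / 2)], which is [2 * d / #|V|]. *)
Lemma card_supergraphs F : 0 < d -> 4 * #|F| + 4 * (d.+1 * d) <= #|V| * d ->
  #|regular_supergraphs F| * #|V| ^ #|F| <=
  (2 * d) ^ #|F| * #|regular_supergraphs set0|.
Proof.
move=> d0; have [n Fn] := ubnP #|F|; elim: n => // n IH in F Fn *.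
case: (set_0Vmem F) => [->|[e eF]] HF; first by rewrite cards0 !expn0 mulnC.
have cF : #|F| = #|F :\ e|.+1 by rewrite (cardsD1 e) eF.
have := @supergraphs_switch F e (#|V| * d - 2 * #|F| - 2 * (d.+1 * d)) eF.
set m := (_ - _ - _)%N; have m2 : #|V| * d <= 2 * m by rewrite /m; lia.
move=> sw; have {}sw := sw _.
have {sw} : #|regular_supergraphs F| * m <=
    #|regular_supergraphs (F :\ e)| * (d * d) by apply: sw; rewrite /m; lia.
have /IH : #|F :\ e| < n by lia.
have -> /= : 4 * #|F :\ e| + 4 * (d.+1 * d) <= #|V| * d by lia.
move=> /(_ isT); rewrite cF !expnS.
move: (#|F :\ e|) (#|regular_supergraphs F|) (#|regular_supergraphs (F :\ e)|).
move=> k a b IHb ab.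
have aV : a * #|V| <= 2 * d * b.
  rewrite -(leq_pmul2r d0) -mulnA; apply: leq_trans (leq_mul (leqnn a) m2) _.
  have := leq_mul (leqnn 2) ab; lia.
rewrite mulnA; apply: leq_trans (leq_mul aV (leqnn _)) _.
by rewrite -mulnA -[X in _ <= X]mulnA leq_mul2l IHb orbT.
Qed.

End Switching.

(** * First moment bounds *)

Section UnionBound.
Import boot.fintype boot.finset.
Local Open Scope set_scope.
Local Open Scope nat_scope.

Lemma expn_le_ffact n j : n ^ j <= (n + j) ^_ j.
Proof.
elim: j => [|j IH]; first by rewrite ffactn0.
by rewrite expnS addnS ffactSS leq_mul // -addnS leq_addr.
Qed.

Lemma bin_le_exp2 n m : 'C(n, m) <= 2 ^ n.
Proof.
elim: n m => [|n IH] [|m]; rewrite ?bin0 ?bin0n ?expn_gt0 // binS expnS mul2n -addnn.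
by rewrite leq_add.
Qed.

(* m ^ m <= (2m)!/m! = C(2m, m) m!, and C(2m, m) <= 4 ^ m *)
Lemma bin_mul_expn n m : 'C(n, m) * m ^ m <= (4 * n) ^ m.
Proof.
have mm : m ^ m <= 4 ^ m * m`!.
  apply: leq_trans (expn_le_ffact m m) _; rewrite -bin_ffact leq_mul2r.
  rewrite addnn -mul2n (_ : 4 ^ m = 2 ^ (2 * m)); last by rewrite expnM.
  by rewrite bin_le_exp2 orbT.
rewrite expnMn; apply: leq_trans (leq_mul (leqnn _) mm) _.
rewrite mulnCA leq_mul2l bin_ffact; apply/orP; right.
elim: {mm} m n => // m IH [|n]; first by rewrite ffact0n.
rewrite ffactSS expnS leq_mul // (leq_trans (IH n)) //.
by case: m {IH} => // m; rewrite leq_exp2r.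
Qed.

Lemma card_bigcup_leq (S T : finType) (Q : pred T) (H : T -> {set S}) :
  #|\bigcup_(t | Q t) H t| <= \sum_(t | Q t) #|H t|.
Proof.
apply: (big_ind2 (fun (A : {set S}) n => #|A| <= n)) => // [|A n A' n' An An'].
  by rewrite cards0.
by have [c _] := leq_card_setU A A'; apply: leq_trans c (leq_add An An').
Qed.

Lemma card_union_bound (S T : finType) (B : {set S}) (Q : pred T) (H : T -> {set S}) :
  (forall x, x \in B -> exists2 t, Q t & x \in H t) ->
  #|B| <= \sum_(t | Q t) #|H t|.
Proof.
move=> BQ; apply: leq_trans (card_bigcup_leq _ _).
by apply/subset_leq_card/subsetP => x /BQ[t tQ xH]; apply/bigcupP; exists t.
Qed.

Lemma exists_subset_card (T : finType) (F : {set T}) m : m <= #|F| ->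
  exists2 F0 : {set T}, F0 \subset F & #|F0| = m.
Proof.
move=> mF; have : 0 < #|[set A : {set T} | (A \subset F) && (#|A| == m)]|.
  by rewrite cards_draws bin_gt0.
by rewrite card_gt0 => /set0Pn[A]; rewrite inE => /andP[? /eqP ?]; exists A.
Qed.

Definition pairs_in (V : finType) (W : {set V}) : {set {set V}} :=
  [set e : {set V} | (e \subset W) && (#|e| == 2)].

(* The least integer m such that k * m >= k.+1 * s. *)
Definition edge_quota k s := (k.+1 * s + k.-1) %/ k.

Lemma edge_quota_min k s f : 0 < k -> k.+1 * s <= k * f -> edge_quota k s <= f.
Proof.
move=> k0 H; rewrite -ltnS ltn_divLR //.
by case: k k0 H => // k _ H; rewrite [f.+1 * _]mulSn [f * _]mulnC; lia.
Qed.

Lemma edge_quota_ge k s : 0 < k -> k.+1 * s <= k * edge_quota k s.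
Proof.
move=> k0; rewrite /edge_quota mulnC.
have := divn_eq (k.+1 * s + k.-1) k.
have := ltn_pmod (k.+1 * s + k.-1) k0; lia.
Qed.

Lemma edge_quota_ge1 k s : 0 < k -> s <= edge_quota k s.
Proof. by move=> k0; rewrite -(leq_pmul2l k0); have := edge_quota_ge s k0; lia. Qed.

Lemma edge_quota_le k s : 0 < k -> edge_quota k s <= 2 * s.
Proof. by move=> k0; apply: edge_quota_min => //; nia. Qed.

(** Shrinking [F] to exactly [edge_quota k #|W|] edges makes the union range over edge sets of one
    prescribed size for each [W]. *)
Lemma dense_subgraphs_bound (V : finType) d k S (B : {set {set {set V}}}) :
  0 < k ->
  (forall E, E \in B -> E \in regular_supergraphs d set0 /\
     exists W F, [/\ subgraph W F E, 0 < #|W|, #|W| <= S &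
                     k.+1 * #|W| <= k * #|F|]) ->
  #|B| <= \sum_(p : {set V} * {set {set V}} |
       [&& 0 < #|p.1|, #|p.1| <= S & (p.2 \subset pairs_in p.1) &&
           (#|p.2| == edge_quota k #|p.1|)])
     #|regular_supergraphs d p.2|.
Proof.
move=> k0 BP.
apply: (card_union_bound (H := fun p => regular_supergraphs d p.2)).
move=> E /BP[]; rewrite inE => /and3P[sE rE _] [W [F [/andP[FE /forall_inP FW] W0 WS WF]]].
have [F0 F0F cF0] := exists_subset_card (edge_quota_min k0 WF).
exists (W, F0) => /=; last by rewrite inE sE rE (subset_trans F0F FE).
rewrite W0 WS cF0 eqxx andbT /=; apply/subsetP => e /(subsetP F0F) eF; rewrite inE FW //=.
by move/forall_inP: sE; apply; exact: (subsetP FE).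
Qed.
End UnionBound.

(** * The expected number of small dense subgraphs *)

Section FirstMoment.
Import boot.fintype boot.finset.
Local Open Scope set_scope.
Local Open Scope ring_scope.
Variable R : realType.

Definition dense_term (N d k s : nat) : R :=
  'C(N, s)%:R * 'C('C(s, 2), edge_quota k s)%:R *
    ((2 * d)%:R / N%:R) ^+ edge_quota k s.

Lemma card_supergraphsR (V : finType) d (F : {set {set V}}) :
  (0 < d)%N -> (0 < #|V|)%N -> (4 * #|F| + 4 * (d.+1 * d) <= #|V| * d)%N ->
  #|regular_supergraphs d F|%:R <=
  ((2 * d)%:R / #|V|%:R) ^+ #|F| * #|regular_supergraphs d (set0 : {set {set V}})|%:R :> R.
Proof.
move=> d0 V0 H; have := card_supergraphs d0 H.
rewrite -(ler_nat R) natrM natrX [X in _ <= X]natrM natrX => {}H.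
rewrite expr_div_n mulrAC ler_pdivlMr // exprn_gt0 // ltr0n //.
Qed.

(** As [edge_quota k s <= 2 * s], the condition on [8 * S] allows [card_supergraphs] for every edge
    set in the union. Grouping the sets [W] by cardinality then produces the binomial
    coefficients. *)
Lemma dense_subgraphs_boundR (V : finType) d k S (B : {set {set {set V}}}) :
  (0 < k)%N -> (0 < d)%N -> (0 < #|V|)%N ->
  (8 * S + 4 * (d.+1 * d) <= #|V| * d)%N ->
  (forall E, E \in B -> E \in regular_supergraphs d set0 /\
     exists W F, [/\ subgraph W F E, (0 < #|W|)%N, (#|W| <= S)%N &
                     (k.+1 * #|W| <= k * #|F|)%N]) ->
  #|B|%:R <= (\sum_(s < S.+1 | (0 < s)%N) dense_term #|V| d k s) *
    #|regular_supergraphs d (set0 : {set {set V}})|%:R.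
Proof.
move=> k0 d0 V0 HS BP; have := dense_subgraphs_bound k0 BP.
rewrite -(ler_nat R) natr_sum => /le_trans; apply.
set G := #|regular_supergraphs d set0|%:R.
pose g s := ((2 * d)%:R / #|V|%:R : R) ^+ edge_quota k s * G.
apply: (@le_trans _ _ (\sum_(p : {set V} * {set {set V}} |
    ((0 < #|p.1|) && (#|p.1| <= S))%N && ((p.2 \subset pairs_in p.1) &&
           (#|p.2| == edge_quota k #|p.1|)%N)) g #|p.1|)).
  rewrite (eq_bigl (fun p : {set V} * {set {set V}} =>
    ((0 < #|p.1|) && (#|p.1| <= S))%N && ((p.2 \subset pairs_in p.1) &&
           (#|p.2| == edge_quota k #|p.1|)%N))); last by move=> p; rewrite /= andbA.
  apply: ler_sum => -[W F] /= /and3P[/andP[W0 WS] FW /eqP cF].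
  rewrite /g -cF; apply: card_supergraphsR => //.
  by have := edge_quota_le #|W| k0; rewrite cF; lia.
rewrite -(pair_big_dep (fun W : {set V} => (0 < #|W|) && (#|W| <= S))%N
   (fun (W : {set V}) (F : {set {set V}}) =>
     (F \subset pairs_in W) && (#|F| == edge_quota k #|W|)%N)
   (fun (W : {set V}) (F : {set {set V}}) => g #|W|)) /=.
rewrite (partition_big (fun W : {set V} => inord #|W| : 'I_S.+1)
   (fun s : 'I_S.+1 => (0 < s)%N)) /=; last first.
  by move=> W /andP[W0 WS]; rewrite inordK.
rewrite mulr_suml; apply: ler_sum => s s0.
rewrite (eq_bigl (fun W : {set V} => W \in [set W : {set V} | #|W| == s])); last first.
  move=> W; rewrite inE; apply/andP/eqP => [[/andP[W0 WS] /eqP <-]|Ws].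
    by rewrite inordK.
  by rewrite Ws s0 -ltnS ltn_ord inord_val eqxx.
rewrite (eq_bigr (fun=> 'C('C(s, 2), edge_quota k s)%:R * g s)); last first.
  move=> W; rewrite inE => /eqP Ws; rewrite Ws.
  rewrite sumr_const -[X in _ *+ X]cardsE (cards_draws (pairs_in W)).
  by rewrite /pairs_in cards_draws Ws mulr_natl.
rewrite sumr_const card_draws /dense_term /g.
by rewrite -[X in X <= _]mulr_natl !mulrA.
Qed.

(** From [bin_mul_expn] at ['C(s, 2)], which is at most [s * s]; since [edge_quota k s >= s], the
    factor [m ^ m] there may be lowered to [s ^ m]. *)
Lemma bin_pairs_le k s : (0 < k)%N -> (0 < s)%N ->
  ('C('C(s, 2), edge_quota k s) <= (4 * s) ^ edge_quota k s)%N.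
Proof.
move=> k0 s0; set m := edge_quota k s.
have sm0 : (0 < s ^ m)%N by rewrite expn_gt0 s0.
rewrite -(leq_pmul2r sm0).
have m0 : (0 < m)%N by apply: leq_trans (edge_quota_ge1 s k0).
apply: (@leq_trans ('C('C(s, 2), m) * m ^ m)%N).
  by rewrite leq_mul2l leq_exp2r // edge_quota_ge1 // orbT.
apply: leq_trans (bin_mul_expn _ _) _; rewrite -expnMn leq_exp2r // -mulnA leq_mul2l /=.
have : (s * s.-1 <= s * s)%N by rewrite leq_mul2l leq_pred orbT.
by rewrite bin2; move: (s * s.-1)%N (s * s)%N; lia.
Qed.

(** The [k]-th power removes the fractional exponent [(1 + 1/k) * s]: the powers of [x] in
    [(4 / x) ^+ (s * k)] and [((8 * d)%:R * x) ^+ (k.+1 * s)] cancel up to one factor [x] per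
    vertex. *)
Lemma dense_term_le (N d k s : nat) (x : R) :
  (0 < k)%N -> (0 < s)%N -> (0 < N)%N -> x = s%:R / N%:R ->
  (8 * d)%:R * x <= 1 ->
  dense_term N d k s ^+ k <= (4 ^+ k * (8 * d)%:R ^+ k.+1 * x) ^+ s.
Proof.
move=> k0 s0 N0 xE C1x; set m := edge_quota k s.
have sR : 0 < s%:R :> R by rewrite ltr0n.
have NR : 0 < N%:R :> R by rewrite ltr0n.
have x0 : 0 < x by rewrite xE divr_gt0.
have C0 : 0 <= (8 * d)%:R * x by rewrite mulr_ge0 // ltW.
have t1 : 'C(N, s)%:R <= (4 / x) ^+ s.
  have := bin_mul_expn N s; rewrite -(ler_nat R) natrM !natrX natrM => H.
  rewrite xE invf_div mulrA expr_div_n ler_pdivlMr // exprn_gt0 //.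
have t2 : 'C('C(s, 2), m)%:R * ((2 * d)%:R / N%:R) ^+ m <= ((8 * d)%:R * x) ^+ m.
  have := bin_pairs_le k0 s0; rewrite -(ler_nat R) natrX -/m => H.
  have -> : (8 * d)%:R * x = (4 * s)%:R * ((2 * d)%:R / N%:R).
    rewrite xE !natrM; ring.
  by rewrite [X in _ <= X]exprMn ler_wpM2r // exprn_ge0 // divr_ge0.
have t0 : 0 <= dense_term N d k s.
  by rewrite /dense_term !mulr_ge0 // exprn_ge0 // divr_ge0.
have : dense_term N d k s <= (4 / x) ^+ s * ((8 * d)%:R * x) ^+ m.
  by rewrite /dense_term -mulrA -/m ler_pM // mulr_ge0 // exprn_ge0 // divr_ge0.
move/(lerXn2r k); rewrite !nnegrE t0 => /(_ isT).
rewrite mulr_ge0 ?exprn_ge0 ?divr_ge0 ?(ltW x0) // => /(_ isT) /le_trans; apply.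
rewrite exprMn -!exprM [(m * k)%N]mulnC.
(* The base [(8 * d)%:R * x] is at most 1, so its exponent may be lowered. *)
apply: (@le_trans _ _ ((4 / x) ^+ (s * k) * ((8 * d)%:R * x) ^+ (k.+1 * s))).
  rewrite ler_wpM2l ?exprn_ge0 ?divr_ge0 ?(ltW x0) //.
  by rewrite ler_wiXn2l // edge_quota_ge.
rewrite [(s * k)%N]mulnC !exprM -exprMn.
rewrite expr_div_n [((8 * d)%:R * x) ^+ _]exprMn [x ^+ k.+1]exprS.
have -> : 4 ^+ k / x ^+ k * ((8 * d)%:R ^+ k.+1 * (x * x ^+ k)) =
          4 ^+ k * (8 * d)%:R ^+ k.+1 * x :> R => //.
by field; rewrite expf_neq0 // gt_eqF.
Qed.

Lemma sum_half_pow S : \sum_(s < S.+1 | (0 < s)%N) (2^-1 : R) ^+ s <= 1.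
Proof.
have -> : \sum_(s < S.+1 | (0 < s)%N) (2^-1 : R) ^+ s = 1 - 2^-1 ^+ S.
  rewrite big_mkcond big_ord_recl /= add0r.
  elim: S => [|S IH]; first by rewrite big_ord0 expr0 subrr.
  by rewrite big_ord_recr /= IH /bump /= add1n exprS; field.
by rewrite gerBl exprn_ge0.
Qed.

(** With [x = s / N], large [N] makes one of the [s] factors [C * x] at most [e ^+ k * s / 4 ^+ k];
    the others are at most [4 ^- k]. The resulting [4 ^- (k * s)] splits into two copies of
    [2 ^- (k * s)], one of which absorbs the factor [s]. *)
Lemma dense_term_small d k (e : R) : (0 < k)%N -> (0 < d)%N -> 0 < e ->
  exists N0, forall N s, (N0 <= N)%N -> (0 < s)%N ->
    4 ^+ k * (4 ^+ k * (8 * d)%:R ^+ k.+1) * s%:R <= N%:R :> R ->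
    dense_term N d k s <= e * 2^-1 ^+ s.
Proof.
move=> k0 d0 e0; set C := 4 ^+ k * (8 * d)%:R ^+ k.+1 : R.
have q0 : 0 < 4 ^+ k :> R by rewrite exprn_gt0.
have C1 : (8 * d)%:R <= C.
  rewrite /C exprS mulrCA ler_peMr // -exprMn.
  by rewrite exprn_ege1 // -natrM ler1n; lia.
have C0 : 0 < C by apply: lt_le_trans C1; rewrite ltr0n; lia.
have ek : 0 < e ^+ k by rewrite exprn_gt0.
exists (Num.truncn (C * 4 ^+ k / e ^+ k)).+1 => N s NN s0 sN.
have NR : C * 4 ^+ k / e ^+ k <= N%:R.
  by apply: le_trans (ltW (truncnS_gt _)) _; rewrite ler_nat.
have N0 : (0 < N)%N by apply: leq_trans NN.
have N0R : 0 < N%:R :> R by rewrite ltr0n.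
have s0R : 0 < s%:R :> R by rewrite ltr0n.
pose x : R := s%:R / N%:R.
have x0 : 0 < x by rewrite divr_gt0.
have Cx : 4 ^+ k * (C * x) <= 1.
  by rewrite /x !mulrA ler_pdivrMr // mul1r -[X in X * s%:R]mulrA.
have C1x : (8 * d)%:R * x <= 1.
  apply: le_trans Cx; rewrite mulrA ler_wpM2r ?(ltW x0) //.
  apply: le_trans C1 _; rewrite ler_peMl ?(ltW C0) // exprn_ege1 // ler1n //.
have := dense_term_le k0 s0 N0 (erefl x) C1x; rewrite -/C.
have t0 : 0 <= dense_term N d k s.
  by rewrite /dense_term !mulr_ge0 // exprn_ge0 // divr_ge0.
move=> tk; rewrite -(@ler_pXn2r _ k) ?nnegrE //; last first.
  by rewrite mulr_ge0 ?(ltW e0) // exprn_ge0.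
apply: le_trans tk _; rewrite [(e * _) ^+ k]exprMn -exprM.
have Cxq : C * x <= (4 ^+ k)^-1 by rewrite -ler_pdivlMl // mulr1 in Cx.
have Cxe : C * x <= e ^+ k * s%:R * (4 ^+ k)^-1.
  rewrite /x mulrA ler_pdivrMr // -(@ler_pM2l _ (4 ^+ k / e ^+ k)) ?divr_gt0 //.
  have -> : 4 ^+ k / e ^+ k * (e ^+ k * s%:R / 4 ^+ k * N%:R) = s%:R * N%:R.
    by field; rewrite !gt_eqF.
  have -> : 4 ^+ k / e ^+ k * (C * s%:R) = s%:R * (C * 4 ^+ k / e ^+ k).
    by clearbody C; field; rewrite gt_eqF.
  by rewrite ler_wpM2l ?(ltW s0R).
have Cx0 : 0 <= C * x by rewrite mulr_ge0 ?ltW.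
apply: (@le_trans _ _ (e ^+ k * s%:R * (4 ^+ k)^-1 ^+ s)).
  case: s s0 sN s0R @x x0 Cx C1x t0 Cxq Cxe Cx0 => // s _ _ s0R x x0 _ _ _ Cxq Cxe Cx0.
  rewrite !exprS [X in _ <= X]mulrA ler_pM ?exprn_ge0 //.
  by rewrite lerXn2r // nnegrE // invr_ge0 ltW.
rewrite -mulrA ler_wpM2l ?(ltW ek) // -exprVn -exprM mulnC.
have -> : 4^-1 = 2^-1 * 2^-1 :> R by field.
rewrite exprMn mulrA ler_piMl ?exprn_ge0 // exprVn ler_pdivrMr ?exprn_gt0 // mul1r.
rewrite -natrX ler_nat; apply: leq_trans (ltnW (ltn_expl s (ltnSn 1))) _.
by rewrite leq_exp2l // leq_pmulr.
Qed.

(** The inequality on [#|F|] says that the average degree is at least [2 + 2/k], cleared of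
    denominators. *)
Definition sparse_below (V : finType) (k : nat) (c : R) (E : {set {set V}}) : Prop :=
  forall W F, subgraph W F E -> (0 < #|W|)%N -> (k.+1 * #|W| <= k * #|F|)%N ->
    c * #|V|%:R <= #|W|%:R.

Lemma few_dense_graphs d k : (0 < k)%N -> (0 < d)%N ->
  exists2 c : R, 0 < c & forall e : R, 0 < e -> exists N0, forall V : finType,
    (N0 <= #|V|)%N ->
    #|[set E in regular_supergraphs d (set0 : {set {set V}}) |
        ~~ `[< sparse_below k c E >]]|%:R <=
    e * #|regular_supergraphs d (set0 : {set {set V}})|%:R.
Proof.
move=> k0 d0.
set C : R := 4 ^+ k * (4 ^+ k * (8 * d)%:R ^+ k.+1).
have C16 : 16 <= C.
  have k4 : 4 <= 4 ^+ k :> R by rewrite ler_eXnr // ler1n.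
  have d1 : 1 <= (8 * d)%:R ^+ k.+1 :> R by rewrite exprn_ege1 // ler1n; lia.
  rewrite (_ : 16 = 4 * (4 * 1)); last by rewrite mulr1 -natrM.
  by rewrite /C !ler_pM.
have C0 : 0 < C by apply: lt_le_trans C16.
exists C^-1; first by rewrite invr_gt0.
move=> e e0; have [N0 HN0] := dense_term_small k0 d0 e0.
exists (maxn N0 (8 * d.+1)) => V; rewrite geq_max => /andP[N0V dV].
have V0 : (0 < #|V|)%N by apply: leq_trans dV.
pose S := Num.truncn (#|V|%:R / C).
have S_le s : (s <= S)%N -> C * s%:R <= #|V|%:R.
  rewrite -(ler_nat R) mulrC -ler_pdivlMr // => /le_trans; apply.
  by rewrite truncn_le divr_ge0 // ltW.
(* Because [16 <= C], the term [8 * S] takes up at most half of [#|V| * d]; the bound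
   [8 * d.+1 <= #|V|] pays for the other term. *)
have S16 : (16 * S <= #|V|)%N.
  rewrite -(ler_nat R) natrM; apply: le_trans (S_le S (leqnn _)).
  by rewrite ler_wpM2r.
have HS : (8 * S + 4 * (d.+1 * d) <= #|V| * d)%N by nia.
apply: le_trans (dense_subgraphs_boundR k0 d0 V0 HS _) _ => [E|].
  rewrite inE => /andP[EG /asboolPn nsp]; split => //.
  move/existsNP: nsp => [W /existsNP[F]].
  move=> /not_implyP[WF /not_implyP[W0 /not_implyP[WFk /negP]]].
  rewrite -ltNge mulrC ltr_pdivlMr // => Wlt; exists W, F; split => //.
  by rewrite /S truncn_ge_nat ?divr_ge0 ?(ltW C0) // ler_pdivlMr // ltW.
rewrite ler_wpM2r //.
apply: (@le_trans _ _ (\sum_(s < S.+1 | (0 < s)%N) e * 2^-1 ^+ s)).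
  by apply: ler_sum => s s0; apply: HN0 => //; apply: S_le; rewrite -ltnS.
by rewrite -mulr_sumr ler_piMr ?(ltW e0) // sum_half_pow.
Qed.

End FirstMoment.

(** * Short cycles in random regular graphs *)

Section FewCycles.
Import boot.fintype boot.finset.
Local Open Scope set_scope.
Local Open Scope nat_scope.

(** This keeps the edges of a cycle distinct: [[set x; next c x] = [set y; next c y]] with [x != y]
    would force [next c (next c x) = x]. *)
Lemma next_next_neq (T : eqType) (c : seq T) x : uniq c -> 2 < size c -> x \in c ->
  next c (next c x) != x.
Proof.
move=> Uc sc xc; have [i c' Ec] := rot_to xc.
rewrite -!(next_rot i Uc) Ec.
have : uniq (rot i c) by rewrite rot_uniq.
have : 2 < size (rot i c) by rewrite size_rot.
rewrite {}Ec; case: c' => [|a [|b s]] //= _; rewrite !inE !negb_or eqxx.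
by move=> /and3P[/and3P[xa xb xs] /andP[ab as_] _]; rewrite [a == x]eq_sym (negbTE xa) eqxx eq_sym.
Qed.

Lemma card_cycle_edges (V : finType) (c : seq V) : uniq c -> 2 < size c ->
  #|cycle_edges c| = size c.
Proof.
move=> Uc sc; rewrite /cycle_edges card_in_imset; first by rewrite (card_uniqP Uc).
move=> x y xc yc /= Exy; have nn := next_next_neq Uc sc.
have : x \in [set y; next c y] by rewrite -Exy !inE eqxx.
have : y \in [set x; next c x] by rewrite Exy !inE eqxx.
rewrite !inE => /orP[/eqP//|/eqP Ey] /orP[/eqP//|/eqP Ex].
by have := nn _ xc; rewrite -Ey -Ex eqxx.
Qed.

Lemma cycle_edges_subset (V : finType) (E : {set {set V}}) c :
  path.cycle (adj E) c -> cycle_edges c \subset E.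
Proof.
move=> cc; apply/subsetP => _ /imsetP[x xc ->].
exact: next_cycle cc xc.
Qed.

Section Counting.
Variables (V : finType) (d : nat).
Let G := regular_supergraphs d (set0 : {set {set V}}).

(** There are at most [#|V| ^ l] vertex tuples, and a given cycle lies in a proportion at most
    [(2 * d / #|V|) ^ l] of the graphs, so the powers of [#|V|] cancel. A cycle is counted once for
    each tuple that traces it, which only weakens the bound. *)
Lemma sum_cycles_of_length l : 0 < d -> 0 < #|V| -> 2 < l ->
  4 * l + 4 * (d.+1 * d) <= #|V| * d ->
  \sum_(E in G) #|cycles_of_length l E| <= (2 * d) ^ l * #|G|.
Proof.
move=> d0 V0 l2 Hl.
have Vl : 0 < #|V| ^ l by rewrite expn_gt0 V0.
apply: (@leq_trans (\sum_(c : l.-tuple V | uniq c)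
    #|regular_supergraphs d (cycle_edges c)|)).
  apply: (@leq_trans (\sum_(E in G) \sum_(c : l.-tuple V | uniq c)
      (cycle_edges c \subset E))).
    apply: leq_sum => E _; rewrite -big_mkcondr sum1dep_card.
    apply: leq_trans (leq_imset_card _ _) _; apply: subset_leq_card.
    apply/subsetP => c; rewrite !inE => /andP[/cycle_edges_subset cE Uc].
    by rewrite Uc cE.
  rewrite exchange_big /=; apply: leq_sum => c _.
  rewrite -big_mkcondr sum1dep_card; apply: subset_leq_card.
  by apply/subsetP => E; rewrite !inE => /andP[/and3P[-> -> _] ->].
rewrite -(leq_pmul2r Vl) big_distrl /=.
apply: (@leq_trans (\sum_(c : l.-tuple V | uniq c) (2 * d) ^ l * #|G|)).
  apply: leq_sum => c Uc; have cl : #|cycle_edges c| = l.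
    by rewrite card_cycle_edges ?size_tuple.
  by have := @card_supergraphs V d (cycle_edges c) d0; rewrite cl; apply.
rewrite sum_nat_const mulnC leq_mul2l; apply/orP; right.
by apply: leq_trans (max_card _) _; rewrite card_tuple.
Qed.

Lemma sum_num_cycles K : 0 < d -> 0 < #|V| ->
  4 * K + 4 * (d.+1 * d) <= #|V| * d ->
  \sum_(E in G) num_cycles K E <= (\sum_(3 <= l < K.+1) (2 * d) ^ l) * #|G|.
Proof.
move=> d0 V0 HK; rewrite exchange_big big_distrl /= !big_nat.
apply: leq_sum => l /andP[l2 lK]; apply: sum_cycles_of_length => //.
by apply: leq_trans HK; rewrite leq_add2r leq_mul2l -ltnS lK orbT.
Qed.
End Counting.

Local Open Scope ring_scope.

(** Each defect affects at most a third of the graphs: small dense subgraphs by hypothesis, many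
    short cycles by Markov's inequality, because the expected number of cycles stays bounded while
    [e * #|V|] grows. That some regular graph exists on [V] is witnessed in (a) by [G_n] itself. *)
Lemma good_regular_graph (R : realType) d k (c : R) : (0 < d)%N ->
  (forall e : R, 0 < e -> exists N0, forall V : finType,
    (N0 <= #|V|)%N ->
    #|[set E in regular_supergraphs d (set0 : {set {set V}}) |
        ~~ `[< sparse_below k c E >]]|%:R <=
    e * #|regular_supergraphs d (set0 : {set {set V}})|%:R) ->
  forall (K : nat) (e : R), 0 < e -> exists N0, forall V : finType,
    (N0 <= #|V|)%N -> (0 < #|regular_supergraphs d (set0 : {set {set V}})|)%N ->
  exists E : {set {set V}}, [/\ simple_graph E, regular d E, sparse_below k c E &
    (num_cycles K E)%:R <= e * #|V|%:R].
Proof.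
move=> d0 few K e e0.
have [|N0 HN0] := few 3^-1; first by rewrite invr_gt0.
set C := (\sum_(3 <= l < K.+1) (2 * d) ^ l)%N.
exists (maxn (maxn N0 (4 * K + 4 * d.+1).+1) (Num.truncn (3 * C%:R / e)).+1) => V.
rewrite !geq_max => /andP[/andP[N0V KV] CV] G0.
have V0 : (0 < #|V|)%N by apply: leq_trans KV.
have := sum_num_cycles (V := V) (K := K) d0 V0.
have -> : (4 * K + 4 * (d.+1 * d) <= #|V| * d)%N by nia.
move=> /(_ isT); rewrite -/C; have := HN0 V N0V.
set G := regular_supergraphs d set0 in G0 *.
have GP E : E \in G -> simple_graph E /\ regular d E by rewrite inE => /and3P[].
clearbody G.
set B := [set E in G | _] => HB HC.
have G0R : 0 < #|G|%:R :> R by rewrite ltr0n.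
have eV0 : 0 < e * #|V|%:R by rewrite mulr_gt0 // ltr0n.
pose B' := [set E in G | ~~ ((num_cycles K E)%:R <= e * #|V|%:R)].
have HB' : #|B'|%:R <= 3^-1 * #|G|%:R :> R.
  rewrite -(ler_pM2r eV0); apply: (@le_trans _ _ (C * #|G|)%:R).
    apply: (@le_trans _ _ (\sum_(E in G) (num_cycles K E)%:R)); last first.
      by rewrite -natr_sum ler_nat.
    rewrite mulr_natl -sumr_const.
    apply: (@le_trans _ _ (\sum_(E in B') (num_cycles K E)%:R)).
      by apply: ler_sum => E; rewrite inE => /andP[_]; rewrite -ltNge => /ltW.
    rewrite [X in _ <= X](big_setID B') /= (setIidPr _) ?lerDl ?sumr_ge0 //.
    by apply/subsetP => E; rewrite inE => /andP[].
  rewrite natrM mulrAC ler_wpM2r // ler_pdivlMl //.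
  have : 3 * C%:R / e <= #|V|%:R.
    by apply: le_trans (ltW (truncnS_gt _)) _; rewrite ler_nat.
  by rewrite ler_pdivrMr // mulrC [X in _ <= X]mulrC.
have : (#|B :|: B'| < #|G|)%N.
  rewrite -(ltr_nat R); have [BB _] := leq_card_setU B B'.
  move: BB; rewrite -(ler_nat R) natrD => BB; lra.
move=> lt; have : ~~ (G \subset B :|: B').
  by apply: contraL lt => /subset_leq_card; rewrite -leqNgt.
case/subsetPn => E EG; rewrite !inE EG /= negb_or !negbK => /andP[/asboolP sp nc].
by have [sE rE] := GP _ EG; exists E.
Qed.
End FewCycles.

(** * Existence of regular graphs *)

Section RandomRegular.
Import boot.fintype boot.finset.
Local Open Scope set_scope.
Local Open Scope nat_scope.

(** A Cayley graph of the cyclic group with connection set [D]. *)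
Lemma circulant_regular n (D : {set 'I_n.+1}) : (0 \notin D)%R ->
  (forall i, i \in D -> (- i)%R \in D) ->
  exists E : {set {set 'I_n.+1}}, simple_graph E && regular #|D| E.
Proof.
move=> D0 Dopp.
pose E := [set [set x; (x + i)%R] | x in [set: 'I_n.+1], i in D].
have sE : simple_graph E.
  apply/forall_inP => _ /imset2P[x i _ iD ->]; rewrite cards2.
  rewrite -[X in X != _]addr0 (inj_eq (addrI x)) [0%R == i]eq_sym.
  by rewrite (_ : i != 0%R) //; apply: contraNneq D0 => <-.
exists E; rewrite sE; apply/forallP => x.
have -> : nbrs E x = [set (x + i)%R | i in D]; last first.
  by rewrite card_imset //; exact: addrI.
apply/setP => y; rewrite in_nbrs; apply/imset2P/imsetP => [[z i _ iD exy]|[i iD ->]].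
  have xy : x != y.
    by apply: (@adj_neq _ E) => //; apply/imset2P; exists z i.
  have : x \in [set z; (z + i)%R] by rewrite -exy !inE eqxx.
  have : y \in [set z; (z + i)%R] by rewrite -exy !inE eqxx orbT.
  rewrite !inE => /orP[]/eqP ? /orP[]/eqP ?; subst; rewrite ?eqxx // in xy *.
    by exists (- i)%R; rewrite ?Dopp // addrK.
  by exists i.
by exists x i; rewrite ?inE.
Qed.

(** [unif_pr] over an empty set is 0, so the limit 1 in (b) requires regular graphs for all large
    admissible [n]. *)
Lemma regular_graph_exists n d : d < n -> ~~ odd (n * d) ->
  exists E : {set {set 'I_n}}, simple_graph E && regular d E.
Proof.
case: n => // n dn ev.
suff [f [f_range f_inj f_opp]] : exists f : 'I_d -> nat,
    [/\ forall i, 0 < f i < n.+1, injective f &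
        forall i, exists j, f j = n.+1 - f i].
  pose D := [set (inord (f i) : 'I_n.+1) | i in [set: 'I_d]].
  have val_f i : (inord (f i) : 'I_n.+1) = f i :> nat.
    by rewrite inordK //; case/andP: (f_range i).
  have cD : #|D| = d.
    rewrite card_imset ?cardsT ?card_ord // => i j /(congr1 val) /=.
    by rewrite !val_f => /f_inj.
  have := @circulant_regular n D; rewrite cD; apply.
    apply/negP => /imsetP[i _ /(congr1 val)] /=; rewrite val_f => /esym fi0.
    by have := f_range i; rewrite fi0.
  move=> _ /imsetP[i _ ->]; have [j fj] := f_opp i; apply/imsetP; exists j => //.
  apply/val_inj; rewrite /= !val_f fj modn_small //.
  by have := f_range i; lia.
(* For odd d the connection set is an interval centred at n/2, for even d it
   consists of +-1, ..., +-d/2. *)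
have [od|ed] := boolP (odd d).
  exists (fun i : 'I_d => n.+1./2 - d./2 + i).
  have en : ~~ odd n.+1 by move: ev; rewrite oddM od andbT.
  have n2 : n.+1 = n.+1./2 + n.+1./2 by rewrite addnn -[LHS]odd_double_half (negbTE en).
  have d2 : d = (d./2 + d./2).+1 by rewrite addnn -[LHS]odd_double_half od.
  split=> [i|i j /addnI /val_inj //|i]; first by have := ltn_ord i; lia.
  by exists (rev_ord i) => /=; have := ltn_ord i; lia.
exists (fun i : 'I_d => if i < d./2 then i.+1 else n - (i - d./2)).
have d2 : d = d./2 + d./2 by rewrite addnn -[LHS]odd_double_half (negbTE ed).
split=> [i|i j|i].
- by have := ltn_ord i; case: ifP; lia.
- move=> H; apply/val_inj; have := ltn_ord i; have := ltn_ord j; move: H => /=.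
  by case: ifP; case: ifP; lia.
case: (ltnP i d./2) => id2.
  have jd : i + d./2 < d by lia.
  by exists (Ordinal jd) => /=; rewrite ifN; lia.
have jd : i - d./2 < d by have := ltn_ord i; lia.
by exists (Ordinal jd) => /=; have id := ltn_ord i; rewrite ifT; lia.
Qed.

Lemma regular_graphsE n d :
  regular_graphs n d = regular_supergraphs d (set0 : {set {set 'I_n}}).
Proof. by apply/setP => E; rewrite !inE sub0set andbT. Qed.

Local Open Scope ring_scope.

Lemma sparse_below_avg_degree (R : realType) (V : finType) k (c delta : R)
    (E : {set {set V}}) : (0 < k)%N -> 2 / delta <= k%:R -> 0 < delta ->
  sparse_below k c E ->
  forall W F, subgraph W F E -> (0 < #|W|)%N -> 2 + delta <= avg_degree R W F ->
    c * #|V|%:R <= #|W|%:R.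
Proof.
move=> k0 kd d0 sp W F WF W0; rewrite /avg_degree ler_pdivlMr ?ltr0n // natrM => H.
apply: sp WF W0 _; rewrite -(ler_nat R) !natrM -natr1.
move: kd; rewrite ler_pdivrMr // => kd.
have W0R : 0 <= #|W|%:R :> R by [].
have k0R : 0 <= k%:R :> R by [].
by nra.
Qed.
End RandomRegular.

(** * The statement for random regular graphs *)

Section PartB.
Local Open Scope classical_set_scope.
Local Open Scope ring_scope.

Lemma regular_graphs_whp (R : realType) d k (c : R)
    (P : forall n, {set {set 'I_n}} -> Prop) : (0 < d)%N ->
  (forall n E, sparse_below k c E -> P n E) ->
  (forall e : R, 0 < e -> exists N0, forall V : finType,
    (N0 <= #|V|)%N ->
    #|[set E in regular_supergraphs d (finset.set0 : {set {set V}}) |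
        ~~ `[< sparse_below k c E >]]%SET|%:R <=
    e * #|regular_supergraphs d (finset.set0 : {set {set V}})|%:R) ->
  (fun n : nat => unif_pr R (regular_graphs n d) (@P n))
      @ within (fun n : nat => ~~ odd (n * d)) \oo --> (1 : R).
Proof.
move=> d0 sP few; apply/cvgrPdist_le => e e0.
rewrite near_withinE; have [N0 HN0] := few e e0.
exists (maxn N0 d.+1) => // n /=; rewrite geq_max => /andP[N0n dn] ev.
have := HN0 'I_n; rewrite card_ord => /(_ N0n).
rewrite /unif_pr regular_graphsE.
set G := regular_supergraphs d finset.set0.
have G0 : (0 < #|G|)%N.
  have [E /andP[sE rE]] := regular_graph_exists dn ev.
  by apply/card_gt0P; exists E; rewrite inE sE rE finset.sub0set.
clearbody G.
set B := [set E in G | ~~ _]%SET; set A := [set x in G | _]%SET => HB.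
have G0R : 0 < #|G|%:R :> R by rewrite ltr0n.
have AG : (#|A| <= #|G|)%N.
  by apply/subset_leq_card/fintype.subsetP => E; rewrite inE => /andP[].
have ABG : (#|G| <= #|A| + #|B|)%N.
  have [AB _] := leq_card_setU A B; apply: leq_trans AB.
  apply/subset_leq_card/fintype.subsetP => E EG; rewrite !inE EG /=.
  by case: (asboolP (sparse_below k c E)) => sp; rewrite ?orbT // orbF; apply/asboolP/sP.
have -> : 1 - #|A|%:R / #|G|%:R = (#|G|%:R - #|A|%:R) / #|G|%:R :> R.
  by field; rewrite gt_eqF.
rewrite ger0_norm; last by rewrite divr_ge0 // subr_ge0 ler_nat.
rewrite ler_pdivrMr //; apply: le_trans HB.
by rewrite lerBlDl -natrD ler_nat.
Qed.
End PartB.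

(** * Tree-like balls and their isomorphisms *)

Section Balls.
Import boot.fintype boot.finset.
Local Open Scope set_scope.
Local Open Scope nat_scope.
Variables (V : finType) (E : {set {set V}}).
Implicit Types (x y v : V) (k r : nat).

Lemma gballS k v y :
  (y \in gball E k.+1 v) = (y \in gball E k v) || [exists x in gball E k v, adj E x y].
Proof. by rewrite /= !inE. Qed.

Lemma gball_nbr k v x y : x \in gball E k v -> adj E x y -> y \in gball E k.+1 v.
Proof. by move=> xk xy; rewrite gballS; apply/orP; right; apply/exists_inP; exists x. Qed.

Lemma gballP k v x :
  reflect (exists p, [/\ path (adj E) v p, last v p = x & size p <= k])
          (x \in gball E k v).
Proof.
elim: k x => [|k IH] x.
  apply: (iffP idP) => [|[[|a p] [] //= _ <- _]]; last by rewrite inE.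
  by rewrite /= inE => /eqP ->; exists [::].
apply: (iffP idP) => [|[p]].
  rewrite gballS => /orP[/IH[p [pp pl ps]]|/exists_inP[z /IH[p [pp pl ps]] zx]].
    by exists p; split=> //; apply: leqW.
  exists (rcons p x); split; last by rewrite size_rcons.
    by rewrite rcons_path pp pl.
  by rewrite last_rcons.
case/lastP: p => [|p z] [pp pl ps].
  by rewrite gballS; apply/orP; left; apply/IH; exists [::].
move: pp pl ps; rewrite rcons_path last_rcons size_rcons ltnS => /andP[pp pz] <- ps.
by apply: gball_nbr pz; apply/IH; exists p.
Qed.

Lemma gball_leq k l v : k <= l -> gball E k v \subset gball E l v.
Proof.
move=> kl; apply/subsetP => x /gballP[p [pp pl ps]].
by apply/gballP; exists p; split=> //; apply: leq_trans kl.
Qed.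

Lemma gball_sym k x y : (x \in gball E k y) = (y \in gball E k x).
Proof.
suff H a b : a \in gball E k b -> b \in gball E k a by apply/idP/idP; apply: H.
move=> /gballP[p [pp <- ps]]; apply/gballP; exists (rev (belast b p)).
rewrite size_rev size_belast ps; split=> //; last first.
  by case: p {pp ps} => //= c p; rewrite rev_cons last_rcons.
rewrite (@rev_path _ (adj E) b p) (eq_path (e' := adj E)) // => u w.
by rewrite /= adjC.
Qed.

Lemma gball_trans k l x y z : x \in gball E k y -> y \in gball E l z ->
  x \in gball E (l + k) z.
Proof.
move=> /gballP[p [pp pl ps]] /gballP[q [qp ql qs]]; apply/gballP.
by exists (q ++ p); rewrite cat_path last_cat size_cat qp ql pp pl leq_add.
Qed.

Lemma card_gball d k v : regular d E -> #|gball E k v| <= d.+1 ^ k.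
Proof.
move=> /forallP rE; elim: k => [|k IH]; first by rewrite /= cards1.
apply: (@leq_trans #|\bigcup_(x in gball E k v) (x |: nbrs E x)|).
  apply: subset_leq_card; apply/subsetP => y; rewrite gballS.
  case/orP => [yk|/exists_inP[x xk xy]]; apply/bigcupP.
    by exists y; rewrite // !inE eqxx.
  by exists x; rewrite // !inE xy orbT.
rewrite expnSr; apply: leq_trans (leq_mul IH (leqnn _)); rewrite -sum_nat_const.
apply: leq_trans (card_bigcup_leq _ _) _; apply: leq_sum => x _.
by rewrite cardsU1 (eqP (rE x)); case: (_ \notin _).
Qed.

(* A vertex at distance k + 1 from v has only its parent as a neighbour within
   distance k + 1. *)
Definition tree_like R v : bool := [forall k : 'I_R, forall y in
  gball E k.+1 v :\: gball E k v, #|nbrs E y :&: gball E k.+1 v| <= 1].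

Lemma tree_likeP R v : tree_like R v -> forall k y x x', k < R ->
  y \in gball E k.+1 v -> y \notin gball E k v ->
  x \in gball E k.+1 v -> x' \in gball E k.+1 v -> adj E y x -> adj E y x' -> x = x'.
Proof.
move=> /forallP T k y x x' kR y1 y0 x1 x1' yx yx'.
have /forall_inP/(_ y) := T (Ordinal kR); rewrite /= in_setD y0 y1 => /(_ isT).
by move=> /card_le1_eqP H; apply: H; rewrite in_setI in_nbrs; apply/andP; split.
Qed.

Lemma tree_like_leq R R' v : R' <= R -> tree_like R v -> tree_like R' v.
Proof.
move=> RR /forallP T; apply/forallP => k.
exact: (T (widen_ord RR k)).
Qed.

(* Two edges from y into the ball close up a cycle with two geodesics to v;
   the cycle is extracted as a shortest detour around the edge yx. *)
Lemma cycle_of_not_tree_like R v : simple_graph E -> ~~ tree_like R v ->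
  exists c : seq V, [/\ ucycleb (adj E) c, 2 < size c <= 2 * R + 2 &
    exists2 y, y \in c & y \in gball E R v].
Proof.
move=> sE /forallPn[[k kR]]; rewrite negb_forall_in => /exists_inP[y].
rewrite in_setD -ltnNge /= => /andP[y0 y1] /card_gt1P[x [x']].
rewrite !in_setI !in_nbrs => -[/andP[yx x1] /andP[yx' x1'] xx'].
pose e a b := adj E a b && ([set a; b] != [set y; x]).
have eC a b : e a b = e b a by rewrite /e adjC setUC.
have ny : y != x by apply: adj_neq yx.
have ny' : y != x' by apply: adj_neq yx'.
have ball_edge a b : a \in gball E k v -> b != y -> adj E a b -> e a b.
  move=> ak bY ab; rewrite /e ab; apply/eqP => /setP/(_ y); rewrite !inE eqxx /=.
  rewrite [y == b]eq_sym (negbTE bY) orbF => /eqP ya; by rewrite ya ak in y0.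
(* A shortest route to [w] stays within distance [k] of [v] until its last step, and [y] is farther
   away. As it does not end at [y] either, it avoids [y] and hence the edge [yx]. *)
have walk j w : j <= k.+1 -> w \in gball E j v -> w != y ->
    exists p, [/\ path e v p, last v p = w & size p <= j].
  elim: j w => [|j IH] w jk; first by rewrite /= inE => /eqP -> _; exists [::].
  have jk' : j <= k by [].
  rewrite gballS => /orP[wj wy|/exists_inP[z zj zw] wy].
    have [p [pp pl ps]] := IH w (ltnW jk) wj wy.
    by exists p; split=> //; apply: leqW.
  have zk : z \in gball E k v by apply: (subsetP (gball_leq _ jk')).
  have zy : z != y by apply: contraNneq y0 => <-.
  have [p [pp pl ps]] := IH z (ltnW jk) zj zy.
  exists (rcons p w); rewrite rcons_path pp pl last_rcons size_rcons; split=> //.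
  exact: ball_edge.
have [p [pp pl ps]] := walk _ _ (leqnn _) x1 (ltac:(by rewrite eq_sym)).
have [q [qp ql qs]] := walk _ _ (leqnn _) x1' (ltac:(by rewrite eq_sym)).
have yx'E : e x' y.
  rewrite /e /adj setUC yx'; apply/eqP => /setP/(_ x'); rewrite !inE eqxx orbT.
  by rewrite [x' == y]eq_sym (negbTE ny') [x' == x]eq_sym (negbTE xx').
pose w := rev (belast v p) ++ rcons q y.
have wl : last x w = y by rewrite /w last_cat last_rcons.
have lv : last x (rev (belast v p)) = v.
  rewrite -pl; case: (p) => //= b s; rewrite rev_cons last_rcons //.
have wp : path e x w.
  rewrite /w cat_path lv rcons_path ql yx'E qp !andbT -pl.
  rewrite rev_path (eq_path (e' := e)) // => a b; exact: eC.
(* Two walks of at most [k.+1] steps and one step to [y]; closing up with [yx] gives at most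
   [2 * k + 4] vertices, hence at most [2 * R + 2]. *)
have ws : size w <= 2 * k + 3.
  rewrite /w size_cat size_rev size_belast size_rcons.
  by move: (size p) (size q) ps qs; clear; lia.
move: wl; case: (shortenP wp) => s sp su ss sl.
have size_s : size s <= 2 * k + 3.
  apply: leq_trans ws; apply: uniq_leq_size ss.
  by case/andP: su.
exists (x :: s); split.
- have ayx : adj E y x by [].
  rewrite /ucycleb su andbT /= rcons_path sl ayx andbT.
  by apply: sub_path sp => a b /andP[].
- rewrite /=; apply/andP; split; last first.
    apply: (@leq_trans (2 * k + 3).+1); first exact: size_s.
    by move: kR; clear; lia.
  (* The detour has at least two steps, since [x != y] and the direct step is the deleted edge. *)
  case: s sp sl {su ss size_s} => [_ /= xy|a [|b s]] //=.
    by rewrite xy eqxx in ny.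
  by rewrite andbT => /andP[_ exa] ay; rewrite ay setUC eqxx in exa.
exists y; first by rewrite -sl mem_last.
by apply: (subsetP (gball_leq _ kR)).
Qed.

(** Every such vertex is within distance [R] of a cycle of length at most [2 * R + 2], and each
    vertex of that cycle has at most [d.+1 ^ R] vertices in its ball. *)
Lemma card_not_tree_like d R : simple_graph E -> regular d E ->
  #|[set v | ~~ tree_like R v]| <=
  num_cycles (2 * R + 2) E * ((2 * R + 2) * d.+1 ^ R).
Proof.
move=> sE rE; set K := 2 * R + 2.
pose Q (p : 'I_K.+1 * {set {set V}}) := (2 < p.1) && (p.2 \in cycles_of_length p.1 E).
have H v : v \in [set v | ~~ tree_like R v] ->
    exists2 p, Q p & v \in \bigcup_(y in cover p.2) gball E R y.
  rewrite inE => /(cycle_of_not_tree_like sE)[c [uc /andP[c2 cK] [y yc yv]]].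
  have cK' : size c < K.+1 by [].
  exists (Ordinal cK', cycle_edges c).
    rewrite /Q c2 /=; apply/imsetP; exists (in_tuple c) => //.
    by rewrite inE.
  apply/bigcupP; exists y; last by rewrite gball_sym.
  apply/bigcupP; exists [set y; next c y]; last by rewrite !inE eqxx.
  by apply/imsetP; exists y.
apply: leq_trans (card_union_bound H) _.
rewrite -(pair_big_dep (fun l : 'I_K.+1 => 2 < l)
  (fun (l : 'I_K.+1) (C : {set {set V}}) => C \in cycles_of_length l E)
  (fun (l : 'I_K.+1) (C : {set {set V}}) => #|\bigcup_(y in cover C) gball E R y|)) /=.
rewrite /num_cycles big_distrl /= big_geq_mkord /=; apply: leq_sum => l l2.
rewrite -sum_nat_const; apply: leq_sum => C /imsetP[c].
rewrite inE => /andP[_ uc] ->.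
apply: leq_trans (card_bigcup_leq _ _) _.
apply: (@leq_trans (\sum_(y in cover (cycle_edges c)) d.+1 ^ R)).
  by apply: leq_sum => y _; apply: card_gball.
rewrite sum_nat_const leq_mul2r; apply/orP; right.
have cl : l <= K by rewrite -ltnS.
apply: leq_trans cl; rewrite -[X in _ <= X](size_tuple c).
apply: leq_trans (card_size c); apply: subset_leq_card.
apply/subsetP => y /bigcupP[_ /imsetP[z zc ->]].
by rewrite !inE => /orP[]/eqP -> //; rewrite mem_next.
Qed.
End Balls.

(** * Isomorphisms between tree-like balls *)

Section LocalIsomorphism.
Import boot.fintype boot.finset.
Local Open Scope set_scope.
Local Open Scope nat_scope.

Lemma perm_extend (T : finType) (B : {set T}) (f : T -> T) :
  {in B &, injective f} -> exists s : {perm T}, {in B, s =1 f}.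
Proof.
have [n Bn] := ubnP #|B|; elim: n => // n IH in B Bn *.
case: (set_0Vmem B) => [->|[b bB]] fI.
  by exists 1%g => x; rewrite inE.
have [||s sf] := IH (B :\ b).
- by move: Bn; rewrite (cardsD1 b) bB.
- by move=> x y /setD1P[_ xB] /setD1P[_ yB]; apply: fI.
exists (s * tperm (s b) (f b))%g => x xB; rewrite permM.
have [->|xb] := eqVneq x b; first by rewrite tpermL.
have sx : s x = f x by apply: sf; rewrite !inE xb.
rewrite tpermD // ?(inj_eq perm_inj) 1?eq_sym //.
by rewrite sx; apply: contra_neq xb => /fI->.
Qed.

Section TwoGraphs.
Variables (V : finType) (d : nat) (E E' : {set {set V}}).
Hypotheses (sE : simple_graph E) (sE' : simple_graph E').
Hypotheses (rE : regular d E) (rE' : regular d E').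
Implicit Types (s : {perm V}).

Definition adj_preserved (B : {set V}) s :=
  {in B &, forall x y, adj E' (s x) (s y) = adj E x y}.

(** A permutation of the whole vertex set, constrained only on the ball, rather than a map between
    balls: permuting all labels by it preserves their joint law. *)
Definition ball_iso R v v' s :=
  [/\ s v = v', s @: gball E R v = gball E' R v' & adj_preserved (gball E R v) s].

(* For x in the R-ball, match the neighbours of x outside the ball with the
   neighbours of s x outside the image ball. *)
Lemma ball_isoS R v v' s : tree_like E R.+1 v -> tree_like E' R.+1 v' ->
  ball_iso R v v' s -> exists s', ball_iso R.+1 v v' s'.
Proof.
move=> T T' [sv sB sA]; set B := gball E R v in sB sA *; set B' := gball E' R v' in sB *.
have sBE x : (s x \in B') = (x \in B) by rewrite -sB (mem_imset _ _ perm_inj).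
have par x x' y : y \notin B -> x \in gball E R.+1 v -> x' \in gball E R.+1 v ->
    adj E y x -> adj E y x' -> y \in gball E R.+1 v -> x = x'.
  by move=> yB xB xB' yx yx' yB1; apply: (tree_likeP T (ltnSn R) yB1 yB xB xB' yx yx').
have par' x x' y : y \notin B' -> x \in gball E' R.+1 v' -> x' \in gball E' R.+1 v' ->
    adj E' y x -> adj E' y x' -> y \in gball E' R.+1 v' -> x = x'.
  by move=> yB xB xB' yx yx' yB1; apply: (tree_likeP T' (ltnSn R) yB1 yB xB xB' yx yx').
have BS x : x \in B -> x \in gball E R.+1 v by move=> xB; rewrite gballS xB.
have BS' x : x \in B' -> x \in gball E' R.+1 v' by move=> xB; rewrite gballS xB.
pose new x := nbrs E x :\: B; pose new' x := nbrs E' x :\: B'.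
(* Both vertices have degree [d] and [s] matches their neighbours inside the balls, so equally many
   remain outside. *)
have card_new x : x \in B -> #|new x| = #|new' (s x)|.
  move=> xB; rewrite !cardsD (eqP (forallP rE x)) (eqP (forallP rE' (s x))).
  congr (_ - _); rewrite -(card_imset _ (@perm_inj _ s)); apply: eq_card => z.
  rewrite in_setI; apply/imsetP/andP => [[y /setIP[xy yB] ->]|[sxz zB]].
    by rewrite sBE yB; split=> //; move: xy; rewrite !inE sA.
  move: zB; rewrite -sB => /imsetP[y yB zE]; exists y => //.
  by rewrite in_setI yB andbT; move: sxz; rewrite zE !inE sA.
(* The parent of [y]; the default is never taken on the outer sphere. *)
pose p y := odflt y [pick x in B | adj E x y].
have pP y : y \in gball E R.+1 v -> y \notin B -> p y \in B /\ adj E (p y) y.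
  rewrite gballS => /orP[->//|/exists_inP[x xB xy] _]; rewrite /p.
  by case: pickP => [z /andP[]//|/(_ x)]; rewrite xB xy.
pose f y := if y \in B then s y else
  nth y (enum (new' (s (p y)))) (index y (enum (new (p y)))).
have p_new y : y \in gball E R.+1 v -> y \notin B -> y \in new (p y).
  by move=> y1 yB; have [_ py] := pP _ y1 yB; rewrite !inE yB.
have f_new y : y \in gball E R.+1 v -> y \notin B -> f y \in new' (s (p y)).
  move=> y1 yB; rewrite /f (negbTE yB) -mem_enum mem_nth // -cardE.
  rewrite -card_new; last by case: (pP _ y1 yB).
  by rewrite cardE index_mem mem_enum p_new.
have f_newP y : y \in gball E R.+1 v -> y \notin B ->
    [/\ f y \notin B', adj E' (s (p y)) (f y) & f y \in gball E' R.+1 v'].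
  move=> y1 yB; have := f_new _ y1 yB; rewrite in_setD in_nbrs => /andP[fB fA]; split => //.
  by apply: gball_nbr fA; rewrite sBE; case: (pP _ y1 yB).
have f_old y : y \in B -> f y = s y by rewrite /f => ->.
have pE x y : x \in B -> y \in gball E R.+1 v -> y \notin B -> adj E x y -> x = p y.
  move=> xB y1 yB xy; have [pB py] := pP _ y1 yB.
  by apply: (par _ _ y) => //; rewrite 1?adjC ?BS.
have fI : {in gball E R.+1 v &, injective f}.
  move=> y z y1 z1; case: (boolP (y \in B)) => yB; case: (boolP (z \in B)) => zB.
  - by rewrite !f_old // => /perm_inj.
  - by move=> fyz; have [] := f_newP _ z1 zB; rewrite -fyz f_old // sBE yB.
  - by move=> fyz; have [] := f_newP _ y1 yB; rewrite fyz f_old // sBE zB.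
  move=> fyz; have [pyB py] := pP _ y1 yB; have [pzB pz] := pP _ z1 zB.
  have [fy0 fya fy1] := f_newP _ y1 yB; have [fz0 fza fz1] := f_newP _ z1 zB.
  have pyz : p y = p z.
    apply: (@perm_inj _ s); apply: (par' _ _ (f y)) => //; rewrite 1?adjC // ?fyz //.
      by rewrite BS' // sBE.
    by rewrite BS' // sBE.
  have := fyz; rewrite /f (negbTE yB) (negbTE zB) -pyz.
  have yi : index y (enum (new (p y))) < size (enum (new' (s (p y)))).
    by rewrite -cardE -card_new // cardE index_mem mem_enum p_new.
  have zi : index z (enum (new (p y))) < size (enum (new' (s (p y)))).
    by rewrite -cardE -card_new // cardE index_mem mem_enum pyz p_new.
  rewrite [in RHS](set_nth_default y) // => /eqP.
  rewrite nth_uniq ?enum_uniq // => /eqP ii.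
  rewrite -(nth_index y (_ : y \in enum (new (p y)))) ?mem_enum ?p_new //.
  by rewrite ii nth_index // mem_enum pyz p_new.
have [s' s'f] := perm_extend fI.
have s'B x : x \in B -> s' x = s x by move=> xB; rewrite s'f ?BS ?f_old.
have vB : v \in B by apply: mem_gball.
exists s'; split; first by rewrite s'B.
  apply/setP => z; apply/imsetP/idP => [[y y1 ->]|z1].
    rewrite s'f //; case: (boolP (y \in B)) => yB; last by case: (f_newP _ y1 yB).
    by rewrite f_old // BS' // sBE.
  case: (boolP (z \in B')) => zB.
    by move: zB; rewrite -sB => /imsetP[y yB ->]; exists y; rewrite ?BS ?s'B.
  move: (z1); rewrite gballS -/B' (negbTE zB) => /exists_inP[x' x'B' x'z].
  move: x'B'; rewrite -/B' -sB => /imsetP[x xB x'E]; rewrite {x'}x'E in x'z.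
  have zn : z \in enum (new' (s x)) by rewrite mem_enum !inE zB.
  set j := index z (enum (new' (s x))).
  have jlt : j < size (enum (new x)) by rewrite -cardE card_new // cardE index_mem.
  pose y := nth z (enum (new x)) j.
  have yn : y \in enum (new x) by apply: mem_nth.
  have := yn; rewrite mem_enum in_setD in_nbrs => /andP[yB xy].
  have y1 : y \in gball E R.+1 v by apply: gball_nbr xy.
  have py := pE _ _ xB y1 yB xy.
  exists y => //; rewrite s'f // /f (negbTE yB) -py /y index_uniq ?enum_uniq //.
  by rewrite nth_index.
move=> x y x1 y1; rewrite !s'f //.
have mixed a b : a \in B -> b \in gball E R.+1 v -> b \notin B ->
    adj E' (f a) (f b) = adj E a b.
  move=> aB b1 bB; rewrite f_old //; have [f0 fa f1] := f_newP _ b1 bB.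
  have [pB pb] := pP _ b1 bB; apply/idP/idP => [h|h]; last by rewrite (pE _ _ aB b1 bB h).
  suff -> : a = p b by [].
  apply: (@perm_inj _ s); apply: (par' _ _ (f b)) => //; rewrite 1?adjC //.
    by rewrite BS' // sBE.
  by rewrite BS' // sBE.
case: (boolP (x \in B)) => xB; case: (boolP (y \in B)) => yB.
- by rewrite !f_old // sA.
- exact: mixed.
- by rewrite adjC mixed // adjC.
(* Two vertices of the outer sphere are adjacent in neither graph: the edge would give one of them a
   second neighbour in the ball besides its parent. *)
have [fx0 fxa fx1] := f_newP _ x1 xB; have [fy0 fya fy1] := f_newP _ y1 yB.
have [pxB px] := pP _ x1 xB.
apply/idP/idP => h.
  have e : f y = s (p x).
    by apply: (par' _ _ (f x)) => //; rewrite 1?adjC // ?BS' ?sBE // adjC.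
  by move: fy0; rewrite e sBE pxB.
have e : y = p x by apply: (par _ _ x) => //; rewrite 1?adjC // ?BS // adjC.
by move: yB; rewrite e pxB.
Qed.

(** Both balls are balls of the [d]-regular tree, and the isomorphism is built sphere by sphere. *)
Lemma ball_iso_exists R v v' : tree_like E R v -> tree_like E' R v' ->
  exists s, ball_iso R v v' s.
Proof.
elim: R => [|R IH] T T'.
  exists (tperm v v'); split; rewrite /= ?imset_set1 ?tpermL //.
  move=> x y; rewrite !inE => /eqP-> /eqP->; rewrite tpermL.
  by apply/idP/idP => /adj_neq; rewrite ?eqxx => /(_ _)/negP; [move/(_ sE')|move/(_ sE)].
have [s sI] := IH (tree_like_leq (leqnSn R) T) (tree_like_leq (leqnSn R) T').
exact: ball_isoS sI.
Qed.

(** As [i + j <= R], paths of length at most [j] from [u] stay in the large ball, so they can be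
    transported in both directions. *)
Lemma ball_iso_sub R v v' s i j u : ball_iso R v v' s ->
  u \in gball E i v -> i + j <= R -> ball_iso j u (s u) s.
Proof.
clear sE sE' rE rE'.
move=> [sv sB sA].
have sub k x : k <= R -> x \in gball E k v -> x \in gball E R v.
  by move=> kR; apply: (subsetP (gball_leq _ _ kR)).
have fwd i' j' u' y : u' \in gball E i' v -> i' + j' <= R -> y \in gball E j' u' ->
    s y \in gball E' j' (s u').
  move=> ui; elim: j' y => [|j' IH] y ij; first by rewrite /= !inE => /eqP->.
  rewrite gballS => /orP[yj|/exists_inP[x xj xy]].
    by rewrite gballS IH // (leq_trans _ ij) // leq_add2l.
  have xR : x \in gball E (i' + j') v by apply: gball_trans xj ui.
  have yR : y \in gball E (i' + j').+1 v by apply: gball_nbr xy.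
  apply: (@gball_nbr _ _ _ _ (s x)); first by apply: IH => //; lia.
  by rewrite sA // ?(sub _ _ _ xR) ?(sub _ _ _ yR) //; lia.
move=> ui ij; split => //; last first.
  move=> x y xj yj; apply: sA; apply: (sub _ _ ij); exact: gball_trans _ ui.
have sui : s u \in gball E' i v'.
  by rewrite -sv; apply: (fwd 0 i v) => //=; rewrite ?inE //; lia.
apply/setP => z; apply/imsetP/idP => [[y yj ->]|]; first exact: fwd ui ij yj.
elim: j z ij => [|j IH] z ij; first by rewrite /= !inE => /eqP->; exists u; rewrite ?inE.
rewrite gballS => /orP[zj|/exists_inP[x' xj xz]].
  have [|y yj ->] := IH z _ zj; first lia.
  by exists y; rewrite // gballS yj.
have [|x xu x'E] := IH x' _ xj; first lia.
have zR : z \in gball E' R v'.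
  apply: (subsetP (gball_leq _ _ ij)); rewrite addnS.
  by apply: gball_nbr xz; apply: gball_trans xj sui.
move: zR; rewrite -sB => /imsetP[y yR zE]; exists y => //.
apply: (gball_nbr xu); move: xz; rewrite x'E zE sA //.
by apply: (sub (i + j)); [lia|apply: gball_trans xu ui].
Qed.

End TwoGraphs.
End LocalIsomorphism.

(** * Invariance of FIID rules under ball isomorphisms *)

Section RuleInvariance.
Import boot.fintype boot.finset.
Local Open Scope set_scope.
Variables (R : realType) (V : finType) (E E' : {set {set V}}).
Hypotheses (sE : simple_graph E) (sE' : simple_graph E').

(** The restriction [h] of [s] to the ball is an isomorphism of rooted graphs, so [rule_iso]
    applies. Edges are pairs, hence preservation of adjacency identifies the edge sets. *)
Lemma fiid_set_iso (f : fiid_rule R) r u (s : {perm V}) (x : V -> R) :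
  ball_iso E E' r u (s u) s ->
  (s u \in fiid_set E' r f x) = (u \in fiid_set E r f (x \o s)).
Proof.
move=> [_ sB sA]; rewrite !inE.
have hP (b : gball_type E r u) : s (val b) \in gball E' r (s u).
  by rewrite -sB imset_f // (valP b).
pose h (b : gball_type E r u) : gball_type E' r (s u) := exist _ (s (val b)) (hP b).
have hI : injective h.
  by move=> a b /(congr1 val) /= /perm_inj/val_inj.
have hB : bijective h.
  apply: inj_card_bij hI _; rewrite !card_sig -sB card_imset //.
  exact: perm_inj.
have -> : gball_root E' r (s u) = h (gball_root E r u) by apply/val_inj.
have -> : x \o s \o val = (x \o val) \o h by [].
rewrite -(rule_iso f _ _ _ hB); congr (f _ _ _ _).
have vh a b : val @: (h @: [set a; b]) = [set s (val a); s (val b)].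
  by rewrite !imsetU1 !imset_set1.
have vE a b : val @: [set a; b] = [set (val a : V); val b].
  by rewrite !imsetU1 !imset_set1.
have vE' (a b : gball_type E' r (s u)) : val @: [set a; b] = [set (val a : V); val b].
  by rewrite !imsetU1 !imset_set1.
apply/setP => e'; apply/idP/imsetP => [|[e + ->]].
  rewrite inE => e'E; have /forall_inP/(_ _ e'E) := sE'.
  rewrite card_imset; last exact: val_inj.
  move=> /cards2P[a' [b' [_ e'E2]]].
  have [g gK hK] := hB.
  exists [set g a'; g b']; last by rewrite !imsetU1 !imset_set1 !hK.
  rewrite inE vE; move: e'E; rewrite e'E2 vE'.
  have := sA _ _ (valP (g a')) (valP (g b')); rewrite /adj => <-.
  by rewrite -[s (val (g a'))]/(val (h (g a'))) -[s (val (g b'))]/(val (h (g b'))) !hK.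
rewrite !inE => eE; have /forall_inP/(_ _ eE) := sE.
rewrite card_imset; last exact: val_inj.
move=> /cards2P[a [b [_ eE2]]]; move: eE; rewrite eE2 vE vh => abE.
by have := sA _ _ (valP a) (valP b); rewrite /adj => ->.
Qed.
End RuleInvariance.

(** * Families of i.i.d. labels *)

Section LawOfTuples.
Local Open Scope classical_set_scope.
Local Open Scope ring_scope.
Local Open Scope ereal_scope.

Definition box k (T : Type) (A : 'I_k -> set T) : set (k.-tuple T) :=
  [set t | forall i, A i (tnth t i)].

Lemma measurable_box d (T : measurableType d) k (A : 'I_k -> set T) :
  (forall i, measurable (A i)) -> measurable (box A).
Proof.
move=> mA; have -> : box A = \bigcap_(i in [set: 'I_k]) (@tnth k T ^~ i @^-1` A i).
  by apply/seteqP; split=> [t tA i _|t tA i]; [exact: tA|exact: (tA i I)].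
apply: fin_bigcap_measurable => // i _; rewrite -[X in measurable X]setTI.
exact: measurable_tnth.
Qed.

(** Boxes are closed under intersection, unlike the coordinate preimages that generate the
    sigma-algebra by definition. *)
Lemma measurable_tupleE d (T : measurableType d) k :
  @measurable _ (k.-tuple T) =
  <<s [set box A | A in [set A : 'I_k -> set T | forall i, measurable (A i)]] >>.
Proof.
apply/seteqP; split.
  apply: smallest_sub; first exact: smallest_sigma_algebra.
  move=> S; rewrite -bigcup_seq /= => -[i _ /= [B mB <-]].
  apply: sub_sigma_algebra; rewrite setTI.
  exists (fun j => if j == i then B else setT).
    by move=> j; case: eqP.
  apply/seteqP; split => [t /(_ i)|t tB j]; first by rewrite eqxx.
  by case: eqP => // ->.
apply: smallest_sub; first exact: sigma_algebra_measurable.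
by move=> _ [A mA <-]; exact: measurable_box.
Qed.

(** Stated for measures, so that it also applies to the restriction of a probability to an event and
    to its multiples. *)
Lemma law_unique d (T : measurableType d) (R : realType)
    (m1 m2 : {measure set T -> \bar R}) k (f g : T -> k.-tuple R) :
  measurable_fun setT f -> measurable_fun setT g -> m1 setT < +oo ->
  (forall A : 'I_k -> set R, (forall i, measurable (A i)) ->
    m1 (f @^-1` box A) = m2 (g @^-1` box A)) ->
  forall S, measurable S -> m1 (f @^-1` S) = m2 (g @^-1` S).
Proof.
move=> mf mg m1oo m12 S mS.
pose p1 := measure_function_pushforward__canonical__measure_function_Measure m1 mf.
pose p2 := measure_function_pushforward__canonical__measure_function_Measure m2 mg.
have := @measure_unique _ R (k.-tuple R)
  [set box A | A in [set A : 'I_k -> set R | forall i, measurable (A i)]]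
  (fun=> setT) (measurable_tupleE _ _) _ _ _ p1 p2.
apply=> //.
- move=> _ _ [A mA <-] [B mB <-]; exists (fun i => A i `&` B i).
    by move=> i; apply: measurableI.
  by apply/seteqP; split => [t AB|t [tA tB] i]; [split=> i; case: (AB i)|split].
- by move=> _; exists (fun=> setT) => //; apply/seteqP; split.
- by rewrite bigcup_const //; exists 0%N.
- by move=> _ [A mA <-]; exact: m12.
Qed.
End LawOfTuples.

(** * The joint law of the labels and the random vertex *)

Section Labels.
Local Open Scope classical_set_scope.
Local Open Scope ring_scope.
Local Open Scope ereal_scope.
Variables (R : realType) (V : finType) (L : labelled_space R V).
Let P := Pr L.
Let U := uniform_prob (@ltr01 R).
Implicit Types (J K : {set V}) (A B : V -> set R).

Definition cylinder J A : set (Omega L) :=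
  \bigcap_(v in [set` J]) (label L v @^-1` A v).

Lemma measurable_label v (B : set R) : measurable B ->
  measurable (label L v @^-1` B).
Proof.
by move=> mB; rewrite -[X in measurable X]setTI; apply: measurable_funPT.
Qed.

Lemma measurable_cylinder J A : (forall v, measurable (A v)) -> measurable (cylinder J A).
Proof.
move=> mA; apply: fin_bigcap_measurable; first exact: finite_finset.
by move=> v _; exact: measurable_label.
Qed.

Let lift_sets A (B : set (Omega L)) (i : option V) : set (Omega L) :=
  if i is Some v then label L v @^-1` A v else B.

Lemma cylinder_prob J A : (forall v, measurable (A v)) ->
  P (cylinder J A) = \prod_(v in J) U (A v).
Proof.
move=> mA; pose J' := [set Some v | v in J]%SET.
have := @label_vertex_independent _ _ L J' (lift_sets A setT).
have -> : \bigcap_(i in [set` J']) lift_sets A setT i = cylinder J A.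
  apply/seteqP; split => [w H v Jv|w H _ /= /imsetP[v vJ ->]]; last exact: H.
  by apply: (H (Some v)); apply/imsetP; exists v.
rewrite big_imset /=; last by move=> ? ? _ _ [].
move=> ->; first by apply: eq_bigr => v _; exact: label_uniform.
by move=> _ /imsetP[v vJ ->]; exists (A v).
Qed.

Lemma vertex_cylinder_prob v0 J A : (forall v, measurable (A v)) ->
  P (cylinder J A `&` vertex (l:=L) @^-1` [set v0]) =
  (#|V|%:R^-1)%:E * P (cylinder J A).
Proof.
move=> mA; pose J' := (None |: [set Some v | v in J])%SET.
pose B := vertex (l:=L) @^-1` [set v0].
have := @label_vertex_independent _ _ L J' (lift_sets A B).
have -> : \bigcap_(i in [set` J']) lift_sets A B i = cylinder J A `&` B.
  apply/seteqP; split => [w H|w [H Bw] i /=].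
    split=> [v Jv|]; last by apply: (H None); rewrite /= !inE.
    by apply: (H (Some v)); rewrite /= !inE /=; apply/imsetP; exists v.
  by rewrite !inE => /predU1P[->//|/imsetP[v vJ ->]]; exact: H.
rewrite big_setU1 /=; last by apply/negP => /imsetP[].
rewrite big_imset /=; last by move=> ? ? _ _ [].
move=> ->; last first.
  move=> i; rewrite !inE => /predU1P[->|/imsetP[v vJ ->]]; first by exists [set v0].
  by exists (A v).
rewrite vertex_uniform cylinder_prob //; congr (_ * _).
by apply: eq_bigr => v _; exact: label_uniform.
Qed.

Lemma cylinder_disjoint J K A B : (forall v, measurable (A v)) ->
  (forall v, measurable (B v)) -> [disjoint J & K]%B ->
  P (cylinder J A `&` cylinder K B) = P (cylinder J A) * P (cylinder K B).
Proof.
move=> mA mB JK; rewrite !cylinder_prob //.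
pose C v := if v \in J then A v else B v.
have vK v : v \in K -> v \in J = false.
  by move=> vK; apply/negbTE; rewrite (disjointFl JK vK).
have -> : cylinder J A `&` cylinder K B = cylinder (J :|: K)%SET C.
  apply/seteqP; split => [w [HA HB] v|w H]; rewrite ?/=.
    rewrite inE /C => /orP[vJ|vK']; first by rewrite vJ; apply: HA.
    by rewrite vK //; apply: HB.
  split=> v /= vJ; first by have := H v; rewrite /= inE /C vJ; exact.
  by have := H v; rewrite /= inE /C vK // vJ; exact.
rewrite cylinder_prob; last by move=> v; rewrite /C; case: ifP.
rewrite (eq_bigl [predU J & K]) => [|v]; last by rewrite !inE.
by rewrite bigU //=; congr (_ * _); apply: eq_bigr => v vJ; rewrite /C ?vJ ?vK.
Qed.

Definition measurable_labelling (Q : (V -> R) -> bool) :=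
  measurable [set t : #|V|.-tuple R | Q (fun v => tnth t (enum_rank v))].

Definition label_event (Q : (V -> R) -> bool) : set (Omega L) :=
  [set w | Q (fun v => label L v w)].

Definition depends_on J (Q : (V -> R) -> bool) :=
  forall x y, {in J, x =1 y} -> Q x = Q y.

Let labels (s : V -> V) (w : Omega L) : #|V|.-tuple R :=
  [tuple label L (s (enum_val i)) w | i < #|V|].

Let measurable_labels s : measurable_fun setT (labels s).
Proof.
apply/measurable_fun_tnthP => i; rewrite (_ : _ \o _ = label L (s (enum_val i))).
  exact: measurable_funPT.
by apply/funext => w; rewrite /= tnth_mktuple.
Qed.

Let label_eventE s (Q : (V -> R) -> bool) :
  labels s @^-1` [set t | Q (fun v => tnth t (enum_rank v))] =
  [set w | Q (fun v => label L (s v) w)].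
Proof.
apply/seteqP; split => w /=; rewrite (_ : (fun v => _) = (fun v => label L (s v) w)) //;
by apply/funext => v; rewrite tnth_mktuple enum_rankK.
Qed.

Let label_event_labels Q :
  label_event Q = labels id @^-1` [set t | Q (fun v => tnth t (enum_rank v))].
Proof. exact/esym/label_eventE. Qed.

Lemma measurable_label_event Q : measurable_labelling Q -> measurable (label_event Q).
Proof.
move=> mQ; rewrite label_event_labels -[X in measurable X]setTI.
exact: measurable_labels.
Qed.

(** The preimage of a box is a cylinder over all of [V], whose probability is a product of factors
    that a permutation only reorders; boxes determine the law. *)
Lemma labels_exchangeable (s : {perm V}) Q : measurable_labelling Q ->
  P [set w | Q (fun v => label L (s v) w)] = P (label_event Q).
Proof.
move=> mQ; rewrite -(label_eventE s Q) label_event_labels.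
apply: law_unique mQ; [exact: measurable_labels|exact: measurable_labels| |].
  exact: le_lt_trans (probability_le1 (Pr L) measurableT) (ltry 1).
have H (t : {perm V}) (A : 'I_#|V| -> set R) : (forall i, measurable (A i)) ->
    P (labels t @^-1` box A) = \prod_i U (A i).
  move=> mA.
  have -> : labels t @^-1` box A = cylinder [set: V]%SET (fun v => A (enum_rank ((t^-1)%g v))).
    apply/seteqP; split => w H.
      by move=> v _ /=; have := H (enum_rank ((t^-1)%g v)); rewrite tnth_mktuple enum_rankK permKV.
    move=> i; rewrite tnth_mktuple; have := H (t (enum_val i)).
    by rewrite /= permK enum_valK; apply; rewrite inE.
  rewrite cylinder_prob // (reindex_inj (@perm_inj _ t)) /=.
  rewrite (eq_bigl xpredT); last by move=> v; rewrite inE.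
  rewrite (reindex _ (onW_bij _ (@enum_val_bij V))) /=.
  by apply: eq_bigr => i _; rewrite permK enum_valK.
move=> A mA; apply: etrans (H s A mA) _; rewrite -(H 1%g A mA).
suff -> : labels (1%g : {perm V}) = labels id by [].
apply/funext => w; apply: eq_from_tnth => i.
by rewrite !tnth_mktuple perm1.
Qed.

(** Extends independence from cylinders to all events determined by the labels in [J]. Leaving [C]
    and [p] arbitrary lets [C] be a cylinder, another label event or the position of the random
    vertex. *)
Lemma label_event_independent J Q (C : set (Omega L)) (p : {nonneg R}) : measurable C ->
  measurable_labelling Q -> depends_on J Q ->
  (forall A, (forall v, measurable (A v)) ->
    P (cylinder J A `&` C) = p%:num%:E * P (cylinder J A)) ->
  P (label_event Q `&` C) = p%:num%:E * P (label_event Q).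
Proof.
move=> mC mQ QJ HC.
(* Q does not see that the labels outside J are replaced by 0. *)
pose f (w : Omega L) : #|V|.-tuple R :=
  [tuple if enum_val i \in J then label L (enum_val i) w else 0%R | i < #|V|].
have mf : measurable_fun setT f.
  apply/measurable_fun_tnthP => i.
  rewrite (_ : _ \o _ = if enum_val i \in J then (label L (enum_val i) : _ -> R)
      else cst 0%R).
    by case: ifP => _; [exact: measurable_funPT|exact: measurable_cst].
  by apply/funext => w; rewrite /= tnth_mktuple; case: ifP.
have fE : f @^-1` [set t | Q (fun v => tnth t (enum_rank v))] = label_event Q.
  apply/seteqP; split => w /=; rewrite (QJ _ (fun v => label L v w)) //;
  by move=> v vJ /=; rewrite tnth_mktuple enum_rankK vJ.
rewrite -fE; have := @law_unique _ _ _ (mrestr P mC) (mscale p P) _ f f mf mf.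
apply=> //.
  by rewrite /= /mrestr setTI (le_lt_trans (probability_le1 _ mC)) ?ltry.
move=> A mA; rewrite /= /mrestr /mscale /=.
(* If a side of the box outside [J] misses 0, the preimage is empty; otherwise it is the cylinder
   over [J]. *)
have [[i [iJ Ai]]|H] := pselect (exists i, enum_val i \notin J /\ ~ A i 0%R).
  have -> : f @^-1` box A = set0.
    by apply/seteqP; split => // w /(_ i); rewrite tnth_mktuple (negbTE iJ).
  by rewrite set0I !measure0 mule0.
have -> : f @^-1` box A = cylinder J (fun v => A (enum_rank v)).
  apply/seteqP; split => w Hw.
    move=> v /= vJ; have := Hw (enum_rank v).
    by rewrite tnth_mktuple enum_rankK vJ.
  move=> i; rewrite tnth_mktuple; case: ifP => [iJ|/negbT iJ].
    by have := Hw _ iJ; rewrite /= enum_valK.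
  by apply: contrapT => Ai; apply: H; exists i.
exact: HC.
Qed.

End Labels.

(** * FIID subgraphs *)

Section FiidLaw.
Local Open Scope classical_set_scope.
Local Open Scope ring_scope.
Local Open Scope ereal_scope.
Variables (R : realType) (V : finType) (L : labelled_space R V).
Variables (r : nat) (f : fiid_rule R).
Let P := Pr L.
Implicit Types (E : {set {set V}}) (A B : pred {set V}) (u v : V).

Lemma measurable_mem_fiid E u :
  measurable_labelling (fun x : V -> R => u \in fiid_set E r f x).
Proof.
pose g (t : #|V|.-tuple R) : #|gball_type E r u|.-tuple R :=
  [tuple tnth t (enum_rank (val (enum_val i))) | i < #|gball_type E r u|].
have mg : measurable_fun setT g.
  apply/measurable_fun_tnthP => i.
  rewrite (_ : _ \o _ = (@tnth _ R)^~ (enum_rank (val (enum_val i)))).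
    exact: measurable_tnth.
  by apply/funext => t; rewrite /= tnth_mktuple.
have := measurableT_comp (rule_measurable f (gball_edges E r u) (gball_root E r u)) mg.
move=> /(_ measurableT [set true] Logic.I); rewrite setTI /measurable_labelling.
congr measurable; apply/seteqP; split => t /=; rewrite inE;
rewrite (_ : (fun b => _) = (fun v => tnth t (enum_rank v)) \o val) //;
by apply/funext => b; rewrite tnth_mktuple enum_rankK.
Qed.

Lemma measurable_fiid E A : measurable_labelling (fun x : V -> R => A (fiid_set E r f x)).
Proof.
rewrite /measurable_labelling.
set F := fun t : #|V|.-tuple R => fiid_set E r f (fun v => tnth t (enum_rank v)).
have -> : [set t | A (F t)] = \bigcup_(W in [set` [set W | A W]%SET])
    \bigcap_(v in [set` [set: V]%SET]) [set t | (v \in F t) = (v \in W)].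
  apply/seteqP; split => [t At|t [W /=]].
    by exists (F t) => //=; rewrite inE.
  rewrite inE => AW H; suff -> : F t = W by [].
  by apply/setP => v; apply: (H v); rewrite /= inE.
apply: fin_bigcup_measurable; first exact: finite_finset.
move=> W _; apply: fin_bigcap_measurable; first exact: finite_finset.
move=> v _; have := measurable_mem_fiid E v; rewrite /measurable_labelling => mv.
case: (v \in W); first exact: mv.
rewrite (_ : [set _ | _] = ~` [set t | v \in F t]); first exact: measurableC.
by apply/seteqP; split => t /=; [move=> ->|move/negP/negbTE].
Qed.

Lemma fiid_depends E u : depends_on (gball E r u) (fun x : V -> R => u \in fiid_set E r f x).
Proof.
move=> x y xy; rewrite !inE; congr (f _ _ _ _).
by apply/funext => b /=; apply: xy; exact: (valP b).
Qed.

Definition omega_event E A : set (Omega L) := [set w | A (omega r f E w)].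

Definition omega_pr E A : R := fine (P (omega_event E A)).

Lemma omega_eventE E A :
  omega_event E A = label_event (L:=L) (fun x => A (fiid_set E r f x)).
Proof. by []. Qed.

Lemma measurable_omega_event E A : measurable (omega_event E A).
Proof. rewrite omega_eventE; apply: measurable_label_event; exact: measurable_fiid. Qed.

Lemma omega_prE E A : P (omega_event E A) = (omega_pr E A)%:E.
Proof. by rewrite fineK // fin_num_measure //; exact: measurable_omega_event. Qed.

Lemma eq_omega_pr E A B : A =1 B -> omega_pr E A = omega_pr E B.
Proof. by move=> AB; congr omega_pr; apply/funext. Qed.

Lemma omega_pr_ge0 E A : (0 <= omega_pr E A)%R.
Proof. exact: fine_ge0. Qed.

Lemma omega_prT E : omega_pr E predT = 1%R.
Proof.
rewrite /omega_pr (_ : omega_event _ _ = setT); first by rewrite probability_setT.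
by apply/seteqP; split.
Qed.

(** The random set takes finitely many values, which lets later expectations be finite sums instead
    of integrals. *)
Lemma omega_pr_sum E A : omega_pr E A = (\sum_(W | A W) omega_pr E (pred1 W))%R.
Proof.
suff H (s : seq {set V}) : uniq s ->
    P (omega_event E (mem s)) = (\sum_(W <- s) omega_pr E (pred1 W))%:E.
  have := H (enum A) (enum_uniq _); rewrite big_enum /= omega_prE => -[<-].
  by apply: eq_omega_pr => W; rewrite /= mem_enum.
elim: s => [_|W s IH /= /andP[Ws us]].
  rewrite big_nil (_ : omega_event _ _ = set0) ?measure0 //.
  by apply/seteqP; split.
rewrite big_cons EFinD -omega_prE -(IH us) -measureU.
- congr (P _); apply/seteqP; split => w /=; rewrite /omega_event /= !inE.
    by case/orP => ?; [left|right].
  by case=> ->; rewrite ?orbT.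
- exact: measurable_omega_event.
- exact: measurable_omega_event.
apply/seteqP; split => // w [/eqP /= WE].
by rewrite /omega_event /= WE (negbTE Ws).
Qed.

(** The ball of radius [r.+1] contains the [r]-balls of [v] and of its neighbour [u], so [s]
    transports both memberships at once, and exchangeability then removes [s] from the labels.
    Taking [u = v] covers a single membership. *)
Lemma omega_pr_iso E E' v v' s u :
  simple_graph E -> simple_graph E' ->
  ball_iso E E' r.+1 v v' s -> u \in gball E 1 v ->
  omega_pr E' (fun W => (v' \in W) && (s u \in W)) =
  omega_pr E (fun W => (v \in W) && (u \in W)).
Proof.
move=> sE sE' H u1; have sv : s v = v' by case: H.
set A := fun W : {set V} => (v \in W) && (u \in W).
have := labels_exchangeable L s (measurable_fiid E A).
rewrite /omega_pr => <-; congr (fine (P _)); apply/seteqP.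
have Hv := ball_iso_sub H (mem_gball E 0 v) (leqnSn r).
have Hu := ball_iso_sub H u1 (leqnn r.+1).
split => w; rewrite /omega_event /omega /= -sv.
  by rewrite (fiid_set_iso sE sE' _ _ Hv) (fiid_set_iso sE sE' _ _ Hu).
by rewrite (fiid_set_iso sE sE' _ _ Hv) (fiid_set_iso sE sE' _ _ Hu).
Qed.

Lemma omega_pr_independent E u v : [disjoint gball E r u & gball E r v]%B ->
  omega_pr E (fun W => (u \in W) && (v \in W)) =
  (omega_pr E (fun W => u \in W) * omega_pr E (fun W => v \in W))%R.
Proof.
move=> dis; pose C w := omega_event E (fun W : {set V} => w \in W).
have mC w : measurable (C w) by exact: measurable_omega_event.
pose pu := NngNum (omega_pr_ge0 E (fun W : {set V} => u \in W)).
have mem_E w : C w = label_event (L:=L) (fun x => w \in fiid_set E r f x) by [].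
(* Two passes: the event at [v] is reduced to cylinders over its ball, then the event at [u] to
   cylinders over the other ball; cylinders over disjoint sets are independent. *)
have : P (C v `&` C u) = pu%:num%:E * P (C v).
  rewrite [C v]mem_E; apply: (label_event_independent (J := gball E r v)) => //.
  - exact: measurable_mem_fiid.
  - exact: fiid_depends.
  move=> A mA; have mD := measurable_cylinder L (gball E r v) mA.
  set D := cylinder (L:=L) (gball E r v) A in mD *.
  have c0 : (0 <= fine (P D))%R by apply: fine_ge0.
  have PD : P D = (NngNum c0)%:num%:E by rewrite /= fineK // fin_num_measure.
  rewrite setIC muleC [in RHS]PD -[pu%:num%:E]omega_prE -/(C u) [C u]mem_E.
  apply: (label_event_independent (J := gball E r u)) => //.
  - exact: measurable_mem_fiid.
  - exact: fiid_depends.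
  by move=> B mB; rewrite -PD muleC; exact: cylinder_disjoint.
rewrite /= [X in _ * X]omega_prE -EFinM => H.
apply: EFin_inj; rewrite -H -omega_prE; congr (P _).
by apply/seteqP; split => [w /andP[]|w [? ?]] //; apply/andP.
Qed.

Lemma vertex_omega_pr E A v :
  P (omega_event E A `&` vertex (l:=L) @^-1` [set v]) = (#|V|%:R^-1 * omega_pr E A)%:E.
Proof.
have n0 : (0 <= #|V|%:R^-1 :> R)%R by rewrite invr_ge0.
rewrite EFinM -omega_prE omega_eventE -[(#|V|%:R^-1)%:E]/((NngNum n0)%:num%:E).
apply: (label_event_independent (J := [set: V]%SET)).
- exact: vertex_measurable.
- exact: measurable_fiid.
- by move=> x y xy; congr (A (fiid_set _ _ _ _)); apply/funext => w; apply: xy; rewrite inE.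
by move=> B mB; exact: vertex_cylinder_prob.
Qed.

Let vertex_event E A v := omega_event E A `&` vertex (l:=L) @^-1` [set v].

Let measurable_vertex_event E A v : measurable (vertex_event E A v).
Proof.
by apply: measurableI; [exact: measurable_omega_event|exact: vertex_measurable].
Qed.

Lemma measurable_vertex_in_omega E : measurable (vertex_in_omega r f E (L:=L)).
Proof.
rewrite (_ : vertex_in_omega r f E (L:=L) =
  \bigcup_(v in [set` [set: V]%SET]) vertex_event E (fun W => v \in W) v).
  by apply: fin_bigcup_measurable => //; exact: finite_finset.
apply/seteqP; split => [w H|w [v _ [H vw]]]; last by rewrite /vertex_in_omega /= vw.
by exists (vertex w) => //=; rewrite ?inE.
Qed.

Lemma integral_sum_events (D : set (Omega L)) (I : finType) (B : I -> set (Omega L))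
    (g : Omega L -> R) : measurable D -> (forall i, measurable (B i)) ->
  (forall i, B i `<=` D) -> (forall w, D w -> g w = (\sum_i \1_(B i) w)%R) ->
  \int[P]_(w in D) (g w)%:E = \sum_i P (B i).
Proof.
move=> mD mB BD gE.
rewrite (eq_integral (fun w => \sum_i (\1_(B i) w)%:E)); last first.
  by move=> w; rewrite inE => Dw; rewrite gE // sumEFin.
rewrite ge0_integral_sum //.
- by apply: eq_bigr => i _; rewrite integral_indic // setIidl.
- move=> i; apply/measurable_EFinP; exact: measurable_indic.
Qed.

Lemma density_atE E : density_at r f E L =
  (#|V|%:R^-1 * \sum_v omega_pr E (fun W => v \in W))%R.
Proof.
have mD := measurable_vertex_in_omega E.
apply: EFin_inj; rewrite /density_at fineK ?fin_num_measure //.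
rewrite -[LHS]mul1e -integral_cst //.
rewrite (integral_sum_events (B := fun v => vertex_event E (fun W => v \in W) v)) //.
- by rewrite mulr_sumr -sumEFin; apply: eq_bigr => v _; exact: vertex_omega_pr.
- by move=> v w [H vw]; rewrite /vertex_in_omega /= vw.
move=> w Dw; rewrite (bigD1 (vertex w)) //= indicE mem_set ?big1 ?addr0 //.
by move=> v vw; rewrite indicE memNset // => -[_ /= wv]; rewrite wv eqxx in vw.
Qed.

Lemma avg_degree_atE E : avg_degree_at r f E L =
  ((#|V|%:R^-1 * \sum_v \sum_(u in nbrs E v)
     omega_pr E (fun W => (v \in W) && (u \in W))) / density_at r f E L)%R.
Proof.
have mD := measurable_vertex_in_omega E.
rewrite /avg_degree_at /cond_expectation; congr (_ / _)%R.
apply: EFin_inj.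
pose A (p : V * V) := [pred W : {set V} | (p.1 \in W) && (p.2 \in W)].
(* On the event that the random vertex is in the set, the indicators of the [B p] add up to its
   degree there. *)
pose B (p : V * V) := if p.2 \in nbrs E p.1 then vertex_event E (A p) p.1 else set0.
rewrite (integral_sum_events (B := B)) //.
- rewrite fineK; last first.
    apply/sum_fin_numP => p _ _; rewrite fin_num_measure // /B.
    by case: ifP.
  rewrite -(pair_bigA _ (fun v u => P (B (v, u)))) /= mulr_sumr -sumEFin.
  apply: eq_bigr => v _; rewrite mulr_sumr -sumEFin [RHS]big_mkcond /=.
  apply: eq_bigr => u _; rewrite /B /=; case: ifP => _; last exact: measure0.
  exact: vertex_omega_pr.
- by move=> p; rewrite /B; case: ifP.
- move=> p w; rewrite /B; case: ifP => // _ [/andP[H _] vw].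
  by rewrite /vertex_in_omega /= vw.
move=> w Dw; rewrite -(pair_bigA _ (fun v u => \1_(B (v, u)) w)) /=.
rewrite (bigD1 (vertex w)) //= [X in (_ + X)%R]big1 ?addr0.
  rewrite /deg_omega -sum1_card natr_sum big_mkcond /=; apply: eq_bigr => u _.
  rewrite finset.inE /B /= indicE; case: (u \in nbrs E _); last by rewrite andbF in_set0.
  rewrite andbT; case: ifP => uw; first by rewrite mem_set //; split=> //; apply/andP.
  by rewrite memNset // => -[/andP[_ /=]]; rewrite uw.
move=> v vw; rewrite big1 // => u _; rewrite indicE memNset // /B /=.
case: ifP => [_ [_ /= wv]|_ []].
by rewrite wv eqxx in vw.
Qed.

End FiidLaw.

(** * Concentration of the size of an FIID set *)

Section SecondMoment.
Import boot.fintype boot.finset.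
Local Open Scope set_scope.
Local Open Scope ring_scope.
Variables (R : realType) (V : finType) (L : labelled_space R V).
Variables (r : nat) (f : fiid_rule R) (d : nat) (E : {set {set V}}).
Hypotheses (sE : simple_graph E) (rE : regular d E).
Implicit Types (W : {set V}) (u v : V) (g : {set V} -> R).

Let pr (A : pred {set V}) : R := omega_pr L r f E A.
Let N : R := #|V|%:R.

Definition omega_mean g : R := \sum_W pr (pred1 W) * g W.

Lemma omega_pr_mean (A : pred {set V}) : pr A = omega_mean (fun W => (A W)%:R).
Proof.
rewrite /pr omega_pr_sum /omega_mean big_mkcond /=; apply: eq_bigr => W _.
by case: (A W); rewrite ?mulr1 ?mulr0.
Qed.

Lemma omega_mean_sum (I : finType) (P : pred I) (g : I -> {set V} -> R) :
  \sum_(i | P i) omega_mean (g i) = omega_mean (fun W => \sum_(i | P i) g i W).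
Proof.
by rewrite exchange_big /=; apply: eq_bigr => W _; rewrite mulr_sumr.
Qed.

Lemma omega_mean_le g h : (forall W, g W <= h W) -> omega_mean g <= omega_mean h.
Proof. by move=> gh; apply: ler_sum => W _; rewrite ler_wpM2l // omega_pr_ge0. Qed.

Lemma omega_meanD g h : omega_mean (fun W => g W + h W) = omega_mean g + omega_mean h.
Proof. by rewrite -big_split /=; apply: eq_bigr => W _; rewrite mulrDr. Qed.

Lemma omega_meanZ c g : omega_mean (fun W => c * g W) = c * omega_mean g.
Proof. by rewrite mulr_sumr; apply: eq_bigr => W _; rewrite mulrCA. Qed.

Lemma omega_mean_cst c : omega_mean (fun=> c) = c.
Proof.
have := omega_pr_mean predT; rewrite /pr omega_prT => H.
by rewrite -[c]mulr1 omega_meanZ -[X in _ * X]/(omega_mean (fun W => (predT W)%:R)) -H.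
Qed.

Definition expected_size : R := \sum_v pr (fun W => v \in W).

Definition expected_degree : R :=
  \sum_v \sum_(u in nbrs E v) pr (fun W => (v \in W) && (u \in W)).

Lemma card_sum_mem W : #|W|%:R = \sum_v (v \in W)%:R :> R.
Proof. by rewrite -sum1_card natr_sum big_mkcond; apply: eq_bigr => v _; case: ifP. Qed.

Lemma expected_sizeE : expected_size = omega_mean (fun W => #|W|%:R).
Proof.
rewrite /expected_size; under eq_bigr do rewrite omega_pr_mean.
by rewrite omega_mean_sum; apply: eq_bigr => W _; rewrite card_sum_mem.
Qed.

Definition degree_sum W : nat := \sum_v \sum_(u in nbrs E v) ((v \in W) && (u \in W)).

Lemma expected_degreeE : expected_degree = omega_mean (fun W => (degree_sum W)%:R).
Proof.
rewrite /expected_degree.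
under eq_bigr => v _.
  under eq_bigr do rewrite omega_pr_mean.
  rewrite omega_mean_sum; over.
rewrite omega_mean_sum; apply: eq_bigr => W _; rewrite /degree_sum natr_sum.
by congr (_ * _); apply: eq_bigr => v _; rewrite natr_sum.
Qed.

Definition induced_edges W : {set {set V}} := [set e in E | e \subset W].

Lemma degree_sum_le_edges W : (degree_sum W <= 2 * #|induced_edges W|)%N.
Proof.
have sF : simple_graph (induced_edges W).
  apply/forall_inP => e; rewrite inE => /andP[eE _].
  by move/forall_inP: sE; apply.
apply: leq_trans (card_ordered_pairs sF); rewrite /degree_sum.
rewrite pair_big_dep /= big_mkcond -sum1_card [leqRHS]big_mkcond /=.
apply: leq_sum => -[v u] _ /=; rewrite in_nbrs !inE.
case vuE: (_ \in E) => //=; case vW: (v \in W) => //=; case uW: (u \in W) => //=.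
by rewrite (_ : _ \subset W) //; apply/subsetP => w; rewrite !inE => /orP[]/eqP ->.
Qed.

Lemma degree_sum_le W : (degree_sum W <= d * #|V|)%N.
Proof.
rewrite mulnC -sum_nat_const; apply: leq_sum => v _.
rewrite -(eqP (forallP rE v)) -sum1_card; apply: leq_sum => u _.
by case: (_ && _).
Qed.

Lemma degree_sum0 : degree_sum set0 = 0%N.
Proof. by rewrite /degree_sum big1 // => v _; rewrite big1 // => u _; rewrite inE. Qed.

(** Sparseness, applied to the edges induced by [W], leaves fewer than [(1 + 1/k) * #|W|] of them;
    the degree sum is at most twice their number. *)
Lemma degree_sum_sparse k (c : R) W : sparse_below k c E -> #|W|%:R < c * N ->
  (k * degree_sum W <= 2 * k.+1 * #|W|)%N.
Proof.
move=> sp Wc; case: (set_0Vmem W) => [->|[v vW]].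
  by rewrite degree_sum0 muln0.
have W0 : (0 < #|W|)%N by apply/card_gt0P; exists v.
have : ~~ (k.+1 * #|W| <= k * #|induced_edges W|)%N.
  apply/negP => /(sp W (induced_edges W) _ W0); rewrite leNgt Wc => /(_ _)/negP.
  apply=> //; apply/andP; split; first by apply/subsetP => e; rewrite inE => /andP[].
  by apply/forall_inP => e; rewrite inE => /andP[].
rewrite -ltnNge => H; apply: leq_trans (_ : k * (2 * #|induced_edges W|) <= _)%N.
  by rewrite leq_mul2l degree_sum_le_edges orbT.
by rewrite mulnCA -mulnA leq_mul2l ltnW.
Qed.

Lemma card_overlapping_balls u :
  (#|[set v | ~~ [disjoint gball E r u & gball E r v]]| <= d.+1 ^ (r + r))%N.
Proof.
apply: leq_trans (card_gball (r + r) u rE); apply: subset_leq_card.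
apply/subsetP => v; rewrite inE -setI_eq0 => /set0Pn[x /setIP[xu xv]].
by apply: gball_trans xu; rewrite gball_sym.
Qed.

(** A double sum of covariances: pairs with disjoint balls contribute 0, and each [u] has at most
    [d.+1 ^ (r + r)] remaining partners, each contributing at most 1. *)
Lemma omega_variance :
  omega_mean (fun W => (#|W|%:R - expected_size) ^+ 2) <= N * (d.+1 ^ (r + r))%:R.
Proof.
have -> : omega_mean (fun W => (#|W|%:R - expected_size) ^+ 2) =
    \sum_u \sum_v (pr (fun W => (u \in W) && (v \in W)) -
      pr (fun W => u \in W) * pr (fun W => v \in W)).
  have -> : \sum_u \sum_v (pr (fun W => (u \in W) && (v \in W)) -
      pr (fun W => u \in W) * pr (fun W => v \in W)) =
      omega_mean (fun W => #|W|%:R ^+ 2) - expected_size ^+ 2.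
    under eq_bigr do rewrite sumrB; rewrite sumrB; congr (_ - _); last first.
      by rewrite expr2 mulr_suml; apply: eq_bigr => u _; rewrite mulr_sumr.
    under eq_bigr => u _.
      under eq_bigr do rewrite omega_pr_mean.
      rewrite omega_mean_sum; over.
    rewrite omega_mean_sum; apply: eq_bigr => W _; congr (_ * _).
    rewrite card_sum_mem expr2 mulr_suml; apply: eq_bigr => u _; rewrite mulr_sumr.
    by apply: eq_bigr => v _; case: (u \in W); case: (v \in W); rewrite ?mulr1 ?mulr0 ?mul0r.
  set S := expected_size.
  rewrite (_ : (fun W => _) = (fun W => #|W|%:R ^+ 2 + ((- (2 * S)) * #|W|%:R + S ^+ 2))).
    by rewrite !omega_meanD omega_meanZ -expected_sizeE omega_mean_cst -/S; ring.
  by apply/funext => W; ring.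
rewrite /N -sum1_card natr_sum mulr_suml; apply: ler_sum => u _; rewrite mul1r.
apply: le_trans (_ : #|[set v | ~~ [disjoint gball E r u & gball E r v]]|%:R <= _).
  rewrite -sum1_card natr_sum [leRHS]big_mkcond /=; apply: ler_sum => v _.
  rewrite inE; case: ifP => [_|/negbFE dis]; last first.
    by rewrite [pr (fun W => _ && _)]omega_pr_independent // subrr.
  rewrite lerBlDr (le_trans (_ : _ <= 1)) ?lerDl ?mulr_ge0 ?omega_pr_ge0 //.
  rewrite omega_pr_mean -[leRHS]omega_mean_cst; apply: omega_mean_le => W.
  by rewrite lern1; case: (_ && _).
by rewrite ler_nat card_overlapping_balls.
Qed.

(* Chebyshev: below size c N the set omega has degree sum at most
   2 (1 + 1/k) |omega|, and |omega| exceeds its mean by t N with probability O(1/N) *)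
Lemma expected_degree_le k (c t : R) : (0 < #|V|)%N -> 0 < t ->
  sparse_below k c E -> expected_size + t * N <= c * N ->
  k%:R * expected_degree <= (2 * k.+1)%:R * expected_size +
    (k * d)%:R * (d.+1 ^ (r + r))%:R / t ^+ 2.
Proof.
move=> V0 t0 sp HS.
have N0 : 0 < N by rewrite ltr0n.
have tN0 : 0 < t * N by rewrite mulr_gt0.
(* Chosen so that [a * (t * N) ^+ 2] is the trivial bound on [k] times the degree sum; the quadratic
   term then covers all sets of size at least [c * N]. *)
pose a := (k * d)%:R * N / (t * N) ^+ 2.
have a0 : 0 <= a by rewrite divr_ge0 ?sqr_ge0 // mulr_ge0 // ltW.
apply: (@le_trans _ _ (omega_mean (fun W => (2 * k.+1)%:R * #|W|%:R +
    a * (#|W|%:R - expected_size) ^+ 2))).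
  rewrite expected_degreeE -omega_meanZ; apply: omega_mean_le => W.
  have sq0 : 0 <= a * (#|W|%:R - expected_size) ^+ 2 by rewrite mulr_ge0 // sqr_ge0.
  have [Wc|cW] := ltP (#|W|%:R) (c * N).
    by rewrite ler_wpDr // -!natrM ler_nat (degree_sum_sparse sp).
  rewrite ler_wpDl ?mulr_ge0 //.
  apply: (@le_trans _ _ ((k * d)%:R * N)).
    by rewrite -natrM -natrM ler_nat -mulnA leq_mul2l degree_sum_le orbT.
  rewrite /a mulrAC ler_pdivlMr ?exprn_gt0 // ler_wpM2l ?mulr_ge0 ?(ltW N0) //.
  have le1 : t * N <= #|W|%:R - expected_size by lra.
  by rewrite lerXn2r // ?nnegrE ?(ltW tN0) // (le_trans _ le1) // ltW.
rewrite omega_meanD !omega_meanZ -expected_sizeE lerD2l.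
apply: (le_trans (ler_wpM2l a0 omega_variance)).
rewrite /a le_eqVlt; apply/orP; left; apply/eqP; field.
by rewrite !gt_eqF.
Qed.

End SecondMoment.

(** * Comparison of two graphs on the same vertices *)

Section Transfer.
Import boot.fintype boot.finset.
Local Open Scope set_scope.
Local Open Scope ring_scope.

(** Since [v] and [v'] vary independently, [a] off [X] and [a'] off [X'] share one constant value,
    and an exceptional vertex costs at most [M]. If [X] or [X'] is all of [V], the error term alone
    bounds the sum. *)
Lemma sum_transfer (R : realType) (V : finType) (a a' : V -> R) (X X' : {set V}) (M : R) :
  (forall v, 0 <= a v <= M) -> (forall v, 0 <= a' v <= M) ->
  (forall v v', v \notin X -> v' \notin X' -> a v = a' v') ->
  \sum_v a' v <= \sum_v a v + M * (#|X| + #|X'|)%:R.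
Proof.
move=> aM aM' aa.
have bound (b : V -> R) (A : {set V}) : (forall v, 0 <= b v <= M) ->
    \sum_(v in A) b v <= M * #|A|%:R.
  move=> bM; rewrite mulr_natr -sumr_const; apply: ler_sum => v _.
  by case/andP: (bM v).
have full : ~: X = set0 \/ ~: X' = set0 ->
    \sum_v a' v <= \sum_v a v + M * (#|X| + #|X'|)%:R.
  move=> XV; apply: (@le_trans _ _ (M * (#|X| + #|X'|)%:R)); last first.
    by rewrite lerDr sumr_ge0 // => v _; case/andP: (aM v).
  (* For empty [V] the hypotheses do not give [0 <= M]. *)
  case: (set_0Vmem [set: V]) => [V0|[v _]].
    rewrite big1 => [|v _]; last by have := in_set0 v; rewrite -V0 inE.
    have V00 (A : {set V}) : A = set0.
      by apply/setP => v; have := in_set0 v; rewrite -V0 inE.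
    by rewrite (V00 X) (V00 X') cards0 mulr0.
  have M0 : 0 <= M by case/andP: (aM v) => *; apply: le_trans (_ : a v <= M).
  have -> : \sum_v a' v = \sum_(v in [set: V]) a' v.
    by apply: eq_bigl => u; rewrite inE.
  apply: le_trans (bound _ _ aM') _; rewrite ler_wpM2l // ler_nat.
  have cX (Y : {set V}) : ~: Y = set0 -> #|[set: V]| = #|Y|.
    by move=> Y0; rewrite -[Y]setCK Y0 setC0.
  by case: XV => /cX ->; rewrite ?leq_addr ?leq_addl.
case: (set_0Vmem (~: X)) => [X0|[v0]]; first by apply: full; left.
case: (set_0Vmem (~: X')) => [X0 _|[v0']]; first by apply: full; right.
rewrite !inE => v0X' v0X.
have M0 : 0 <= M by case/andP: (aM v0) => *; apply: le_trans (_ : a v0 <= M).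
have a'c v : v \notin X' -> a' v = a v0 by move=> vX; rewrite (aa v0 v).
have ac v : v \notin X -> a v = a v0 by move=> vX; rewrite (aa v v0') // (aa v0 v0').
have split (b : V -> R) (A : {set V}) : \sum_v b v =
    \sum_(v in A) b v + \sum_(v in ~: A) b v.
  by rewrite (bigID (mem A)) /=; congr (_ + _); apply: eq_bigl => v; rewrite !inE.
rewrite (split a' X') (split a X).
have s' := bound a' X' aM'.
have n0 : 0 <= \sum_(v in X) a v by apply: sumr_ge0 => v _; case/andP: (aM v).
have e' : \sum_(v in ~: X') a' v = a v0 * (#|V|%:R - #|X'|%:R).
  rewrite (eq_bigr (fun=> a v0)) => [|v]; last by rewrite inE => /a'c.
  rewrite sumr_const -[LHS]mulr_natr; congr (_ * _).
  by rewrite -(cardsC X') natrD addrC addKr.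
have e : \sum_(v in ~: X) a v = a v0 * (#|V|%:R - #|X|%:R).
  rewrite (eq_bigr (fun=> a v0)) => [|v]; last by rewrite inE => /ac.
  rewrite sumr_const -[LHS]mulr_natr; congr (_ * _).
  by rewrite -(cardsC X) natrD addrC addKr.
rewrite e e' natrD mulrDr.
have /andP[a0 aM0] := aM v0.
have m1 : a v0 * #|X|%:R <= M * #|X|%:R by rewrite ler_wpM2r.
have m2 : 0 <= a v0 * #|X'|%:R by rewrite mulr_ge0.
lra.
Qed.

Section TwoGraphs.
Variables (R : realType) (V : finType) (L : labelled_space R V).
Variables (r : nat) (f : fiid_rule R) (d : nat) (E E' : {set {set V}}).
Hypotheses (sE : simple_graph E) (rE : regular d E).
Hypotheses (sE' : simple_graph E') (rE' : regular d E').

Let X (F : {set {set V}}) := [set v | ~~ tree_like F r.+1 v].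

Lemma omega_pr_le1 F (A : pred {set V}) : omega_pr L r f F A <= 1.
Proof.
rewrite omega_pr_mean -[leRHS](omega_mean_cst L r f F); apply: omega_mean_le => W.
by rewrite lern1; case: (A W).
Qed.

Lemma expected_size_transfer :
  expected_size L r f E' <= expected_size L r f E + (#|X E| + #|X E'|)%:R.
Proof.
rewrite -[X in _ + X]mul1r; apply: sum_transfer.
- by move=> v; rewrite omega_pr_ge0 omega_pr_le1.
- by move=> v; rewrite omega_pr_ge0 omega_pr_le1.
move=> v v'; rewrite !inE !negbK => T T'.
have [s H] := ball_iso_exists sE sE' rE rE' T T'.
have := omega_pr_iso L f sE sE' H (mem_gball E 1 v).
have [-> _ _] := H.
rewrite (eq_omega_pr _ _ _ _ (B := fun W => v' \in W)) => [->|W]; last exact: andbb.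
by apply: eq_omega_pr => W; rewrite andbb.
Qed.

Lemma ball_iso_nbrs R0 v v' s : ball_iso E E' R0.+1 v v' s ->
  nbrs E' v' = s @: nbrs E v.
Proof.
move=> [sv _ sA]; apply/esym/eqP; rewrite eqEcard; apply/andP; split; last first.
  by rewrite card_imset ?(eqP (forallP rE v)) ?(eqP (forallP rE' v')) //; exact: perm_inj.
apply/subsetP => _ /imsetP[u uv ->]; have vu : adj E v u by rewrite inE in uv.
have vb := mem_gball E 0 v.
have sub : gball E 1 v \subset gball E R0.+1 v by apply: gball_leq.
have ub : u \in gball E 1 v by apply: gball_nbr vu.
by rewrite inE -sv sA // ?(subsetP sub) // mem_gball.
Qed.

(** The direction is opposite to that of [expected_size_transfer]: the size has to be small in [E'],
    while the degree sum in [E] has to be bounded by the one in [E']. *)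
Lemma expected_degree_transfer :
  expected_degree L r f E <= expected_degree L r f E' + d%:R * (#|X E'| + #|X E|)%:R.
Proof.
have bd F v : regular d F ->
    0 <= \sum_(u in nbrs F v) omega_pr L r f F (fun W => (v \in W) && (u \in W)) <= d%:R.
  move=> rF; rewrite sumr_ge0 => [|u _]; last exact: omega_pr_ge0.
  rewrite /= -(eqP (forallP rF v)) -sum1_card natr_sum.
  by apply: ler_sum => u _; exact: omega_pr_le1.
apply: sum_transfer => [v|v|v' v]; [exact: bd|exact: bd|].
rewrite !inE !negbK => T' T.
have [s H] := ball_iso_exists sE sE' rE rE' T T'.
rewrite (ball_iso_nbrs H) big_imset /=; last by move=> ? ? _ _; exact: perm_inj.
apply: eq_bigr => u uv; apply: (omega_pr_iso L f sE sE' H).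
by apply: gball_nbr (mem_gball E 0 v) _; rewrite inE in uv.
Qed.

(** Here [e] bounds the proportion of vertices without a tree-like ball, and [t] is the Chebyshev
    margin. The coefficient of [e] collects an error [2 * e] in the size, weighted by [2 * k.+1],
    and [2 * d * e] in the degree sum, weighted by [k]. *)
Lemma density_degree_bound k (c e t : R) : (0 < #|V|)%N -> 0 < t ->
  sparse_below k c E' ->
  #|X E|%:R <= e * #|V|%:R -> #|X E'|%:R <= e * #|V|%:R ->
  0 < density_at r f E L -> density_at r f E L + 2 * e + t <= c ->
  k%:R * (avg_degree_at r f E L * density_at r f E L) <=
  (2 * k.+1)%:R * density_at r f E L + (4 * k.+1 + 2 * (k * d))%:R * e +
    (k * d)%:R * (d.+1 ^ (r + r))%:R / t ^+ 2 / #|V|%:R.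
Proof.
move=> V0 t0 sp HX HX' dens0 Hc.
have N0 : 0 < #|V|%:R :> R by rewrite ltr0n.
set N : R := #|V|%:R in N0 HX HX' *.
have key := @expected_degree_le R V L r f d E' sE' rE' k c t V0 t0 sp.
have T_le := expected_degree_transfer; have S_le := expected_size_transfer.
have SE : expected_size L r f E = N * density_at r f E L.
  by rewrite density_atE mulVKf ?gt_eqF.
have TE : expected_degree L r f E = N * (avg_degree_at r f E L * density_at r f E L).
  by rewrite avg_degree_atE mulfVK ?gt_eqF // mulVKf ?gt_eqF.
rewrite natrD in S_le; rewrite natrD in T_le.
set dens := density_at r f E L in dens0 Hc SE TE *.
set avg := avg_degree_at r f E L in TE *.
rewrite {}SE in S_le; rewrite {}TE in T_le; rewrite -/N in key.
set S' := expected_size L r f E' in key S_le.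
set T' := expected_degree L r f E' in key T_le.
set Z := (k * d)%:R * _ / _ in key *.
have S'_le : S' <= N * (dens + 2 * e) by lra.
have {}key : k%:R * T' <= (2 * k.+1)%:R * S' + Z.
  apply: key; apply: (@le_trans _ _ (N * (dens + 2 * e) + t * N)); first by rewrite lerD2r.
  by rewrite [c * N]mulrC [t * N]mulrC -mulrDr ler_wpM2l // ltW.
have T_le' : N * (avg * dens) <= T' + d%:R * (2 * e * N).
  by apply: le_trans T_le _; rewrite lerD2l ler_wpM2l //; lra.
rewrite -(ler_pM2l N0) !mulrDr.
have -> : N * (Z / N) = Z by rewrite mulrC divfK // gt_eqF.
have k1 : k%:R * (N * (avg * dens)) <= k%:R * (T' + d%:R * (2 * e * N)) by rewrite ler_wpM2l.
have k2 : (2 * k.+1)%:R * S' <= (2 * k.+1)%:R * (N * (dens + 2 * e)) by rewrite ler_wpM2l.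
rewrite natrD (natrM _ 4) (natrM _ 2 (k * d)) (natrM _ k d).
rewrite (natrM _ 2) in key k2 *.
apply: le_trans (_ : _ <= k%:R * (T' + d%:R * (2 * e * N))) _; first by rewrite mulrCA.
apply: le_trans (_ : _ <= 2 * k.+1%:R * S' + Z + k%:R * (d%:R * (2 * e * N))) _.
  by rewrite mulrDr lerD2r.
apply: le_trans (_ : _ <= 2 * k.+1%:R * (N * (dens + 2 * e)) + Z + k%:R * (d%:R * (2 * e * N))) _.
  by rewrite !lerD2r.
rewrite le_eqVlt; apply/orP; left; apply/eqP; ring.
Qed.

End TwoGraphs.
End Transfer.

(** * The lower bound on the density of FIID subgraphs *)

Section PartA.
Local Open Scope classical_set_scope.
Local Open Scope ring_scope.

Lemma cvg_of_lim_neq0 (R : realType) (u : nat -> R) : lim (u @ \oo) != 0 -> cvg (u @ \oo).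
Proof. by apply: contraNP => du; rewrite dvgP. Qed.

Lemma fiid_density_lower_bound (R : realType) (d k : nat) (c delta : R) :
  (0 < d)%N -> 0 < delta -> 4 / delta <= k%:R -> (0 < k)%N ->
  (forall e : R, 0 < e -> exists N0, forall V : finType,
    (N0 <= #|V|)%N ->
    #|[set E in regular_supergraphs d (finset.set0 : {set {set V}}) |
        ~~ `[< sparse_below k c E >]]%SET|%:R <=
    e * #|regular_supergraphs d (finset.set0 : {set {set V}})|%:R) ->
  forall (V : nat -> finType) (E : forall n, {set {set V n}}),
    (forall n, simple_graph (E n)) -> (forall n, regular d (E n)) ->
    essentially_large_girth R E ->
  forall (L : forall n, labelled_space R (V n)) (r : nat) (f : fiid_rule R),
    0 < fiid_density r f E L -> 2 + delta <= fiid_avg_degree r f E L ->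
    c <= fiid_density r f E L.
Proof.
move=> d0 delta0 kdelta k0 few V E sE rE [V_oo girth] L r f dens0 avg2.
set rho := fiid_density r f E L in dens0 *.
rewrite leNgt; apply/negP => rho_c.
have kR : 0 < k%:R :> R by rewrite ltr0n.
have cvg_dens : (fun n => density_at r f (E n) (L n)) @ \oo --> rho.
  by apply: cvg_of_lim_neq0; rewrite gt_eqF.
have cvg_avg : (fun n => avg_degree_at r f (E n) (L n)) @ \oo --> fiid_avg_degree r f E L.
  by apply: cvg_of_lim_neq0; rewrite gt_eqF // (lt_le_trans _ avg2) // addr_gt0.
(* Room for three errors: the deviation of the density from its limit, [2 * e], and the Chebyshev
   margin. *)
pose t := (c - rho) / 3.
have t0 : 0 < t by rewrite divr_gt0 // subr_gt0.
(* The two error terms will be at most [a] each, against a gap of at least [4 * a]: eventually the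
   density is at least [rho / 2], and [k * (an - 2) - 2 >= k * delta / 4] because
   [k * delta >= 4]. *)
pose a := k%:R * rho * delta / 32.
have a0 : 0 < a by rewrite divr_gt0 // !mulr_gt0.
pose C : R := (4 * k.+1 + 2 * (k * d))%:R.
have C0 : 0 < C by rewrite ltr0n.
pose e := Num.min (t / 2) (a / C).
have e0 : 0 < e by rewrite lt_min; apply/andP; split; apply: divr_gt0.
have et : 2 * e <= t by rewrite -ler_pdivlMl // mulrC ge_min lexx.
have eC : C * e <= a by rewrite -ler_pdivlMl // mulrC ge_min lexx orbT.
(* Degrees involve the [r]-balls of neighbours, hence radius [r.+1]; [K] and [M] are the constants
   of [card_not_tree_like] at this radius. *)
pose K := (2 * r.+1 + 2)%N.
pose M := (K * d.+1 ^ r.+1)%N.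
have M0 : 0 < M%:R :> R by rewrite ltr0n muln_gt0 expn_gt0.
have eM0 : 0 < e / M%:R by rewrite divr_gt0.
have [N1 good] := good_regular_graph d0 few K eM0.
pose Z : R := (k * d)%:R * (d.+1 ^ (r + r))%:R / t ^+ 2.
have Z0 : 0 <= Z by rewrite divr_ge0 ?sqr_ge0 // mulr_ge0.
pose N2 := Num.max N1.+1%:R (Z / a).
have near_V : \forall n \near \oo, N2 <= #|V n|%:R by move/cvgryPge: V_oo; apply.
have near_E : \forall n \near \oo, (num_cycles K (E n))%:R <= e / M%:R * #|V n|%:R.
  have /eqoP/(_ _ eM0) := girth K.
  by apply: filterS => n /=; rewrite !ger0_norm.
have near_dens : \forall n \near \oo, `|rho - density_at r f (E n) (L n)| < Num.min t (rho / 2).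
  by move/cvgrPdist_lt: cvg_dens; apply; rewrite lt_min t0 divr_gt0.
have near_avg : \forall n \near \oo,
    `|fiid_avg_degree r f E L - avg_degree_at r f (E n) (L n)| < delta / 4.
  by move/cvgrPdist_lt: cvg_avg; apply; rewrite divr_gt0.
near \oo => n.
have hV : N2 <= #|V n|%:R by near: n.
have hE : (num_cycles K (E n))%:R <= e / M%:R * #|V n|%:R by near: n.
have hD : `|rho - density_at r f (E n) (L n)| < Num.min t (rho / 2) by near: n.
have hA : `|fiid_avg_degree r f E L - avg_degree_at r f (E n) (L n)| < delta / 4 by near: n.
move: hV; rewrite ge_max ler_nat => /andP[N1V ZV].
have V0 : (0 < #|V n|)%N by apply: leq_ltn_trans N1V.
have VR : 0 < #|V n|%:R :> R by rewrite ltr0n.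
have [||E' [sE' rE' sp cyc']] := good (V n); first exact: ltnW.
  by apply/card_gt0P; exists (E n); rewrite inE sE rE finset.sub0set.
have bad (F : {set {set V n}}) : simple_graph F -> regular d F ->
    (num_cycles K F)%:R <= e / M%:R * #|V n|%:R ->
    #|[set v | ~~ tree_like F r.+1 v]%SET|%:R <= e * #|V n|%:R :> R.
  move=> sF rF cycF; have := card_not_tree_like r.+1 sF rF.
  rewrite -(ler_nat R) natrM => /le_trans; apply.
  by rewrite -ler_pdivlMr // mulrAC.
move: hD; rewrite lt_min !ltr_norml => /andP[/andP[hD1 hD2] /andP[hD3 hD4]].
move: hA; rewrite ltr_norml => /andP[hA1 hA2].
have dens_n0 : 0 < density_at r f (E n) (L n) by lra.
have dens_c : density_at r f (E n) (L n) + 2 * e + t <= c by rewrite /t in et hD1 hD2 *; lra.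
have := @density_degree_bound R (V n) (L n) r f d (E n) E' (sE n) (rE n) sE' rE'
  k c e t V0 t0 sp (bad _ (sE n) (rE n) hE) (bad _ sE' rE' cyc') dens_n0 dens_c.
rewrite -/C -/Z; set dn := density_at _ _ _ _ in hD1 hD2 hD3 hD4 dens_n0 dens_c *.
set an := avg_degree_at _ _ _ _ in hA1 hA2 *.
have Zn : Z / #|V n|%:R <= a.
  by rewrite ler_pdivrMr // mulrC -ler_pdivrMr.
have an2 : 2 + 3 / 4 * delta <= an by lra.
have k4 : 4 <= k%:R * delta by rewrite -ler_pdivrMr.
have main : 4 * a <= k%:R * (an * dn) - (2 * k.+1)%:R * dn.
  have -> : k%:R * (an * dn) - (2 * k.+1)%:R * dn = dn * (k%:R * (an - 2) - 2).
    by rewrite natrM -natr1; ring.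
  have -> : 4 * a = (rho / 2) * (k%:R * delta / 4) by rewrite /a; field.
  apply: ler_pM; [lra|by rewrite divr_ge0 // mulr_ge0 // ltW|lra|].
  have : k%:R * (3 / 4 * delta) <= k%:R * (an - 2) by rewrite ler_wpM2l ?(ltW kR) //; lra.
  lra.
lra.
Unshelve. all: by end_near.
Qed.
End PartA.

Local Open Scope classical_set_scope.
Local Open Scope ring_scope.

Theorem theorem1p13 (R : realType) (d : nat) (delta : R)
    (hd : (3 <= d)%N) (hdelta : 0 < delta) :
  exists c : R, 0 < c /\
    (forall (V : nat -> finType) (E : forall n, {set {set V n}}),
        (forall n, simple_graph (E n)) ->
        (forall n, regular d (E n)) ->
        essentially_large_girth R E ->
      forall (L : forall n, labelled_space R (V n)) (r : nat)
          (f : fiid_rule R),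
        0 < fiid_density r f E L ->
        2 + delta <= fiid_avg_degree r f E L ->
        c <= fiid_density r f E L) /\
    ((fun n : nat => unif_pr R (regular_graphs n d)
        (fun E => forall (W : {set 'I_n}) (F : {set {set 'I_n}}),
          subgraph W F E -> (0 < #|W|)%N ->
          2 + delta <= avg_degree R W F -> c * n%:R <= #|W|%:R))
      @ within (fun n : nat => ~~ odd (n * d)) \oo --> (1 : R)).
Proof.
have d0 : (0 < d)%N by apply: leq_trans hd.
pose k := (Num.truncn (4 / delta)).+1.
have k4 : 4 / delta <= k%:R by exact: ltW (truncnS_gt _).
have [c c0 few] := few_dense_graphs R (ltn0Sn _ : (0 < k)%N) d0.
exists c; split => //; split; first exact: fiid_density_lower_bound few.
apply: (regular_graphs_whp (P := fun n E => forall (W : {set 'I_n}) (F : {set {set 'I_n}}),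
  subgraph W F E -> (0 < #|W|)%N ->
  2 + delta <= avg_degree R W F -> c * n%:R <= #|W|%:R) d0 _ few).
move=> n E sp W F WF W0 deg; rewrite -[n in n%:R]card_ord.
apply: (sparse_below_avg_degree (k := k) (delta := delta) _ _ hdelta sp WF W0 deg) => //.
by apply: le_trans k4; rewrite ler_pM2r ?invr_gt0 // ler_nat.
Qed.
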